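(* For all positive integers $n$ and integers $k\ge 0$, \[S_{n,k}=\begin{cases}\displaystyle\sum_{C\in\mathcal S_{n,k}}t^{\mathsf{area}(C)} & \text{if } n-k \text{ is odd},\\[2mm] 0 & \text{if } n-k\text{ is even},\end{cases}\] where $\mathsf{area}(C)$ denotes the common area of all paths in the class $C$.
   Context: Paths. A square path of size $n$ is a lattice path from $(0,0)$ to $(n,n)$ of unit north (vertical) and east (horizontal) steps whose last step is east. The $j$-th diagonal is the set of unit squares with two vertices on $y=x+j$. Each vertical step is identified with the unit square of which it is the left edge. Area word: $a_i=j$ if the $i$-th vertical step starts on $y=x+j$. Shift $s=-\min_i a_i$; area $=\sum_i(a_i+s)$. A labeling is a word $w=w_1\cdots w_n$ of positive integers ($w_i$ in the square of the $i$-th vertical step) strictly increasing upward within each column; standard if the labels are $1,\dots,n$. The $i$-th vertical step is a contractible valley if ($i>1$ and $a_{i-1}>a_i$) or ($i>1$, $a_{i-1}=a_i$, $w_{i-1}<w_i$) or ($i=1$ and $a_1\le-1$). A decorated labeled square path $(\pi,w,dv)$ has $dv$ a set of contractible valleys (decorated steps); $\mathsf{LSQ}(n)^{\bullet k}$ is the set of those with exactly $k$ decorations and $\mathsf{stLSQ}(n)^{\bullet k}$ the standardly labeled ones. Attack pair: $i<j$ with $i\notin dv$ and either ($a_i=a_j$, $w_i<w_j$) or ($a_i=a_j+1$, $w_i>w_j$). $\mathsf{dinv}(P)=\#\{\text{attack pairs}\}+\#\{i:a_i<0\}-k$. $S_{n,k}=\sum_{P\in\mathsf{stLSQ}(n)^{\bullet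 k}}(-1)^{\mathsf{dinv}(P)}t^{\mathsf{area}(P)}$. Schedule word. For $P\in\mathsf{stLSQ}(n)^{\bullet k}$ with shift $s$, let $\rho_i$ be the labels in the $(i-s)$-th diagonal in decreasing order, each marked decorated if its step is decorated; the diagonal word is $\mathsf{dw}(P)=\rho_0\rho_1\cdots$, a decorated permutation. For a decorated permutation $\sigma$ with maximal decreasing runs $\rho_0\cdots\rho_l$, $\tilde\rho_i$ the undecorated letters of $\rho_i$ ($\rho_{l+1}=\emptyset$), and shift $s\in\{0,\dots,l\}$, the schedule number of $c\in\rho_i$ is $\#\{d\in\tilde\rho_i:d>c\}+1$ if $i=s$ and $c$ undecorated; $\#\{d\in\tilde\rho_i:d>c\}+\#\{d\in\tilde\rho_{i-1}:d<c\}$ if $i>s$ and $c$ undecorated; $\#\{d\in\tilde\rho_i:d<c\}+\#\{d\in\tilde\rho_{i+1}:d>c\}$ if $i<s$ or $c$ decorated (all $0$ if $s>l$). The schedule word $\mathsf{sched}(P)$ lists the schedule numbers of the letters of $(\mathsf{dw}(P),s)$; $\mathsf{sched}(P)=1^n$ means they all equal $1$. Cutting. For $P\in\mathsf{LSQ}(n)^{\bullet k}$ and $i\in[n]$, write $P=P_1P_2$ where $P_1$ ends with the $i$-th east step, and let $\psi_i(P)=P_2P_1$ (steps carrying their labels and decorations). The cutting cycle is $\mathcal{CC}(P)=\{\psi_i(P):i\in[n]\}\cap\mathsf{LSQ}(n)^{\bullet k}$ (those $\psi_i(P)$ that are valid decorated labeled square paths). Write $P\sim Q$ iff $Q\in\mathcal{CC}(P)$;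 this is an equivalence relation whose classes share a common area. $\mathcal S_{n,k}=\{P\in\mathsf{stLSQ}(n)^{\bullet k}:\mathsf{sched}(P)=1^n\}/\sim$. *)

(* Defs.v *)
From HB Require Import structures.
From mathcomp Require Import all_boot all_order all_algebra.

Set Implicit Arguments.
Unset Strict Implicit.
Unset Printing Implicit Defensive.

Import Order.TTheory GRing.Theory Num.Theory.
Local Open Scope ring_scope.

(* A decorated labeled lattice path (pi, w, dv) is stored as one sequence of
   steps carrying their labels and decorations:
     None        == an east step,
     Some (c, b) == a north step with label c, decorated iff b.
   The index i of a north step starts at 0 instead of 1. *)
Definition step := option (nat * bool).
Definition lpath := seq step.

Definition is_north (x : step) : bool := isSome x.
Definition is_east (x : step) : bool := ~~ isSome x.

Section Paths.
Local Open Scope nat_scope.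
Implicit Types (P : lpath) (i j m : nat).

(* The starting point of the m-th step of P (m counted from 0). *)
Definition xcoord P m : nat := count is_east (take m P).
Definition ycoord P m : nat := count is_north (take m P).

Definition north_pos P : seq nat :=
  [seq m <- iota 0 (size P) | is_north (nth None P m)].
Definition east_pos P : seq nat :=
  [seq m <- iota 0 (size P) | is_east (nth None P m)].

Definition area_word P : seq int :=
  [seq ((ycoord P m)%:Z - (xcoord P m)%:Z)%R | m <- north_pos P].
Definition columns P : seq nat := [seq xcoord P m | m <- north_pos P].
Definition letters P : seq (nat * bool) := pmap id P.
Definition labels P : seq nat := [seq x.1 | x <- letters P].
Definition decs P : seq bool := [seq x.2 | x <- letters P].

Definition aw P i : int := nth 0%R (area_word P) i.
Definition col P i : nat := nth 0 (columns P) i.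
Definition lab P i : nat := nth 0 (labels P) i.
Definition dec P i : bool := nth false (decs P) i.

Definition nb_north P : nat := count is_north P.
Definition nb_dec P : nat := count id (decs P).

(* In a path starting at (0,0) the first vertical step starts on or below the
   main diagonal, so the minimum is <= 0 and the absolute value of its opposite
   is this opposite. *)
Definition shift P : nat :=
  absz (- \big[Order.min/aw P 0]_(a <- area_word P) a)%R.

(* Each summand is nonnegative. *)
Definition area P : nat := absz (\sum_(a <- area_word P) (a + (shift P)%:Z))%R.

Definition square_path n P : bool :=
  [&& size P == n + n, nb_north P == n & is_east (last None P)].

Definition labeling P : bool :=
  all (fun c => 0 < c) (labels P) &&
  [forall i : 'I_(nb_north P), forall j : 'I_(nb_north P),
     (i < j) && (col P i == col P j) ==> (lab P i < lab P j)].

Definition contractible P i : bool :=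
  if i is i'.+1 then
    (aw P i < aw P i')%R || ((aw P i' == aw P i) && (lab P i' < lab P i))
  else (aw P 0 <= -1)%R.

Definition LSQ n k P : bool :=
  [&& square_path n P, labeling P,
      [forall i : 'I_(nb_north P), dec P i ==> contractible P i]
    & nb_dec P == k].

Definition standard n P : bool := perm_eq (labels P) (iota 1 n).

Definition attack P i j : bool :=
  [&& i < j, ~~ dec P i
    & ((aw P i == aw P j) && (lab P i < lab P j))
      || ((aw P i == (aw P j + 1)%R) && (lab P j < lab P i))].

Definition nb_attack P : nat :=
  #|[set ij : 'I_(nb_north P) * 'I_(nb_north P) | attack P ij.1 ij.2]|.

Definition dinv P : int :=
  ((nb_attack P)%:Z + (count (fun a : int => a < 0) (area_word P))%:Z
   - (nb_dec P)%:Z)%R.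

End Paths.

Section Schedule.
Local Open Scope nat_scope.
Implicit Types (P : lpath) (sigma : seq (nat * bool)) (rs : seq (seq (nat * bool))).

Definition rho P i : seq (nat * bool) :=
  sort (fun x y => y.1 <= x.1)
    [seq v.2 | v <- zip (area_word P) (letters P)
             & v.1 == (i%:Z - (shift P)%:Z)%R].

(* For a square path of size n the area word has entries in [-n, n), so adding
   the shift gives entries in [0, 2n) = [0, size P) and the omitted rho P i are
   empty. *)
Definition dw P : seq (nat * bool) :=
  flatten [seq rho P i | i <- iota 0 (size P)].

(* Maximal decreasing runs of a decorated word. *)
Fixpoint runs sigma : seq (seq (nat * bool)) :=
  if sigma is x :: sigma' then
    if runs sigma' is (y :: r) :: rs then
      if y.1 < x.1 then (x :: y :: r) :: rs else [:: x] :: (y :: r) :: rs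
    else [:: [:: x]]
  else [::].

(* The undecorated letters of the i-th run; empty past the last run. *)
Definition urun rs i : seq nat := [seq d.1 | d <- nth [::] rs i & ~~ d.2].

Definition sched_num rs (s i : nat) (c : nat * bool) : nat :=
  if (i < s) || c.2 then
    count (fun d => d < c.1) (urun rs i) + count (fun d => c.1 < d) (urun rs i.+1)
  else if i == s then
    count (fun d => c.1 < d) (urun rs i) + 1
  else
    count (fun d => c.1 < d) (urun rs i) + count (fun d => d < c.1) (urun rs i.-1).

Definition sched_word sigma (s : nat) : seq nat :=
  let rs := runs sigma in
  if s < size rs then
    flatten [seq [seq sched_num rs s i c | c <- nth [::] rs i]
            | i <- iota 0 (size rs)]
  else nseq (size sigma) 0.

Definition sched P : seq nat := sched_word (dw P) (shift P).

End Schedule.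

Section Cutting.
Local Open Scope nat_scope.
Implicit Types P Q : lpath.

(* The index i ranges over 1, ..., n: the prefix moved to the end is the one
   ending with the i-th east step. *)
Definition psi i P : lpath :=
  let m := (nth 0 (east_pos P) i.-1).+1 in drop m P ++ take m P.

Definition CC n k P : seq lpath :=
  [seq Q <- [seq psi i P | i <- iota 1 n] | LSQ n k Q].

Definition cut_equiv n k P Q : bool := Q \in CC n k P.

End Cutting.

(* Standardly labeled paths of size n have labels < n.+1, so they live in the
   finite type [stpath n]; [to_lpath] is the (injective) embedding. *)
Definition stpath (n : nat) := ((n + n)%N).-tuple (option ('I_n.+1 * bool)).

Definition to_lpath (n : nat) (P : stpath n) : lpath :=
  [seq omap (fun x : 'I_n.+1 * bool => (nat_of_ord x.1, x.2)) y | y <- P].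

Definition stLSQ (n k : nat) : {set stpath n} :=
  [set P : stpath n | LSQ n k (to_lpath P) && standard n (to_lpath P)].

Definition S_poly (n k : nat) : {poly int} :=
  \sum_(P in stLSQ n k) ((-1 : int) ^ dinv (to_lpath P)) *: 'X^(area (to_lpath P)).

Definition sched_one (n k : nat) : {set stpath n} :=
  [set P in stLSQ n k | sched (to_lpath P) == nseq n 1%N].

Definition cut_classes (n k : nat) : {set {set stpath n}} :=
  equivalence_partition
    (fun P Q : stpath n => cut_equiv n k (to_lpath P) (to_lpath Q))
    (sched_one n k).

(* The area is constant on cutting classes: read it off any representative. *)
Definition class_area (n : nat) (C : {set stpath n}) : nat :=
  if [pick P in C] is Some P then area (to_lpath P) else 0%N.

(* Main.v *)
From HB Require Import structures.
From mathcomp Require Import all_boot all_order all_algebra.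
From mathcomp Require Import zify ring.
Require Import Defs.
Import Order.TTheory GRing.Theory Num.Theory.

Set Implicit Arguments.
Unset Strict Implicit.
Unset Printing Implicit Defensive.

(* A path of shift [s] is encoded by the word of its letters (level, label,
   decoration), where level = area word entry + s.  Recording the cut of the
   cyclic path as one more decorated letter, of level [s] and of label larger
   than all others, turns the validity of a path into the condition that
   consecutive letters of a cyclic word are compatible.  Inserting the letters
   one at a time (decorated ones last) proves that the paths with a given set of
   letters and shift [s] have generating function
   q^(undecorated letters below s) * prod [schedule number]_q.
     At q = -1 this is a sign if all schedule numbers are odd, and 0 otherwise.
   If they are all odd then they are all 1: every level has at most two
   undecorated letters, consecutive levels interlace, and the level [s] has a
   single undecorated letter; the same then holds for every other level with a
   single undecorated letter.  The signs of these levels alternate, so their sum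
   is 1 or 0 according to the parity of n - k.  Finally, for each of these shifts
   there is exactly one path with the given letters, and any two of them are
   cuts of each other. *)

Local Open Scope nat_scope.

(** * Words, gaps and insertions *)

Definition letter := (nat * (nat * bool))%type.
Definition lv (x : letter) : nat := x.1.
Definition lb (x : letter) : nat := x.2.1.
Definition dc (x : letter) : bool := x.2.2.

(** [p] may immediately precede [x] on a path. An undecorated [x] climbs at most one level, and a
    climb stays in the column, hence increases the label; a decorated [x] is a contractible valley.
    The weak inequality lets the marker follow itself, so that the empty word is valid. *)
Definition follows (p x : letter) : bool :=
  if dc x then (lv x < lv p) || ((lv x == lv p) && (lb p <= lb x))
  else (lv x <= lv p) || ((lv x == (lv p).+1) && (lb p < lb x)).

Definition attacks (x y : letter) : bool :=
  ~~ dc x && (((lv x == lv y) && (lb x < lb y))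
              || ((lv x == (lv y).+1) && (lb y < lb x))).

Fixpoint nattacks (u : seq letter) : nat :=
  if u is x :: u' then count (attacks x) u' + nattacks u' else 0.

(* The cut of a path of shift [s] whose labels are smaller than [N]. *)
Definition marker (N s : nat) : letter := (s, (N, true)).

(** For labels below [N], the conditions at the marker are those at the ends of a path: the last
    letter has level at least [s], since the last step is east, and the first has level at most [s],
    strictly less if it is decorated. *)
Definition valid (N s : nat) (u : seq letter) : bool :=
  cycle follows (marker N s :: u).

Definition ins (T : Type) (j : nat) (c : T) (u : seq T) : seq T :=
  take j u ++ c :: drop j u.

Definition inserts (T : Type) (c : T) (u : seq T) : seq (seq T) :=
  [seq ins j c u | j <- iota 0 (size u).+1].

(** Built by successive insertions, so that sums over arrangements can be computed one letter at a
    time. *)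
Fixpoint perms (T : Type) (X : seq T) : seq (seq T) :=
  if X is c :: X' then flatten [seq inserts c u | u <- perms X'] else [:: [::]].

Lemma perm_ins (T : eqType) j (c : T) u : perm_eq (ins j c u) (c :: u).
Proof. by rewrite /ins -cat1s perm_catCA cat1s cat_take_drop. Qed.

Lemma mem_perms (T : eqType) (X u : seq T) : (u \in perms X) = perm_eq u X.
Proof.
elim: X u => [|c X IH] u /=; first by rewrite inE; apply/eqP/idP => [->//|/perm_nilP].
apply/flatten_mapP/idP => [[v]|].
  rewrite IH => pv /mapP[j _ ->]; rewrite (perm_trans (perm_ins _ _ _)) //.
  by rewrite perm_cons.
move=> pu; have cu : c \in u by rewrite (perm_mem pu) mem_head.
case/splitPr: cu pu => u1 u2 pu.
exists (u1 ++ u2).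
  by rewrite IH -(perm_cons c) -(permPr pu) -cat1s perm_catCA.
apply/mapP; exists (size u1); first by rewrite mem_iota size_cat /=; lia.
by rewrite /ins take_size_cat // drop_size_cat.
Qed.

Lemma ins_inj (T : eqType) (c : T) u v i j : c \notin u -> c \notin v ->
  i <= size u -> j <= size v -> ins i c u = ins j c v -> (u = v) /\ (i = j).
Proof.
move=> cu cv iu jv E.
have idx (w : seq T) k : c \notin w -> k <= size w -> index c (ins k c w) = k.
  move=> cw kw; rewrite /ins index_cat /= eqxx addn0 size_take_min.
  rewrite ifN; last by apply: contra cw => /mem_take.
  by lia.
have ij : i = j by rewrite -(idx u i) // E idx.
split=> //; subst j.
have rmv (w : seq T) k : c \notin w -> filter (predC1 c) (ins k c w) = w.
  move=> cw; rewrite /ins filter_cat /= eqxx -filter_cat cat_take_drop.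
  by apply/all_filterP/allP => x xw /=; apply: contraNneq cw => <-.
by rewrite -(rmv u i) // E rmv.
Qed.

Lemma perms_uniq (T : eqType) (X : seq T) : uniq X -> uniq (perms X).
Proof.
elim: X => [|c X IH] //= /andP[cX uX].
have nc u : u \in perms X -> c \notin u by rewrite mem_perms => /perm_mem->.
have {IH}:= IH uX; elim: (perms X) nc => [|u L IHL] // nc; rewrite cons_uniq => /andP[uL UL].
rewrite (_ : flatten _ = inserts c u ++ flatten (map (inserts c) L)) // cat_uniq IHL ?andbT //; last by move=> v vL; apply: nc; rewrite inE vL orbT.
apply/andP; split.
  have cu : c \notin u by apply: nc; rewrite mem_head.
  rewrite /inserts.
  rewrite map_inj_in_uniq ?iota_uniq // => i j; rewrite !mem_iota => hi hj E.
  by have [] := @ins_inj _ c u u i j cu cu _ _ E => //; lia.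
apply/hasPn => w /flatten_mapP[v vL /mapP[j hj ->]].
apply/negP.
move=> /mapP[i hi E]; move: hi hj; rewrite !mem_iota => hi hj.
have [] // := @ins_inj _ c v u j i _ _ _ _ E; try lia.
- by apply: nc; rewrite inE vL orbT.
- by apply: nc; rewrite mem_head.
by move=> evu; rewrite -evu vL in uL.
Qed.

Lemma nattacks_cat_cons u v c :
  nattacks (u ++ c :: v) =
  nattacks (u ++ v) + count (attacks^~ c) u + count (attacks c) v.
Proof. by elim: u => [|x u IH] //=; rewrite ?IH ?count_cat /=; lia. Qed.

Lemma nattacks_ins j c u :
  nattacks (ins j c u) =
  nattacks u + count (attacks^~ c) (take j u) + count (attacks c) (drop j u).
Proof. by rewrite /ins nattacks_cat_cons cat_take_drop. Qed.

(** The hypothesis is transitivity of [e] through [c] at this gap: it makes the removal of [c]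
    harmless. *)
Lemma path_ins (T : Type) (e : rel T) j c u p z :
  (forall p' x', e p' c -> e c x' -> p' = last p (take j u) ->
     x' = head z (drop j u) -> e p' x') ->
  path e p (rcons (ins j c u) z) =
  [&& path e p (rcons u z), e (last p (take j u)) c & e c (head z (drop j u))].
Proof.
move=> tr; rewrite -{2}(cat_take_drop j u) /ins !rcons_cat !cat_path rcons_cons /=.
move: tr; set p' := last p _; move=> tr.
case: (drop j u) tr => [|y v] /= tr; rewrite ?andbT;
  case E1: (e p' c) => /=; rewrite ?andbF //=;
  match goal with |- context[e c ?x] => case E2: (e c x) => /=; rewrite ?andbF //= end.
  by rewrite (tr p' z) ?andbT.
by rewrite (tr p' y) ?andbT.
Qed.

(** * q-weighted sums over the gaps of a word *)

Section GapSums.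
Variables (R : comNzRingType) (q : R) (T : Type).
Implicit Types (H K A : pred T) (u : seq T) (p z : T).
Local Open Scope ring_scope.

Definition qint (w : nat) : R := \sum_(0 <= i < w) q ^+ i.

Lemma qint0 : qint 0 = 0. Proof. by rewrite /qint big_geq. Qed.
Lemma qintS w : qint w.+1 = qint w + q ^+ w.
Proof. by rewrite /qint big_nat_recr. Qed.
Lemma qintSl w : qint w.+1 = 1 + q * qint w.
Proof.
rewrite /qint big_nat_recl // expr0 mulr_sumr; congr (_ + _).
by apply: eq_bigr => i _; rewrite exprS.
Qed.

(** [H] tests the left neighbour of a gap and [K] the right one, with [p] and [z] as neighbours at
    the two ends. *)
Definition gapsum H K (f : seq T -> seq T -> nat) p u z : R :=
  \sum_(0 <= j < (size u).+1)
    (H (last p (take j u)) && K (head z (drop j u)))%:R * q ^+ f (take j u) (drop j u).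

Lemma gapsum_nil H K f p z : gapsum H K f p [::] z = (H p && K z)%:R * q ^+ f [::] [::].
Proof. by rewrite /gapsum /= big_nat1. Qed.

Lemma gapsum_cons H K f p y u z :
  gapsum H K f p (y :: u) z =
  (H p && K y)%:R * q ^+ f [::] (y :: u) + gapsum H K (fun a b => f (y :: a) b) y u z.
Proof. by rewrite /gapsum /= big_nat_recl. Qed.

Lemma gapsum_expD H K m f p u z :
  gapsum H K (fun a b => m + f a b)%N p u z = q ^+ m * gapsum H K f p u z.
Proof. by rewrite mulr_sumr; apply: eq_bigr => j _; rewrite exprD; ring. Qed.

(* With [L := ~~ K], every admissible gap [(p, x)] contributes [H p - L x], and
   [H y = L y + A y] makes the sum telescope. *)
Lemma gapsum_between H K A p u z :
  all (fun y => if A y then H y && K y else H y == ~~ K y) u ->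
  path (fun p x => H p || K x) p (rcons u z) ->
  gapsum H K (fun a _ => count A a) p u z + (~~ K z)%:R * q ^+ count A u
  = (H p)%:R + q * qint (count A u).
Proof.
elim: u p => [|y u IH] p /=.
  rewrite gapsum_nil /= qint0 expr0 !mulr1 mulr0 addr0 andbT => _.
  by case: (H p); case: (K z) => //= _; ring.
move=> /andP[hy hu] /andP[hpy hp]; rewrite gapsum_cons /= expr0 mulr1.
rewrite gapsum_expD exprD.
have {IH}/(congr1 (fun x => q ^+ A y * x)) := IH y hu hp; rewrite mulrDr => E.
rewrite mulrCA -addrA {}E.
case: (A y) hy => /=; rewrite ?addn1 ?add1n ?add0n ?expr1 ?expr0 ?mul1r.
  by move=> /andP[-> ->]; rewrite andbT qintSl mulr1n.
by move=> /eqP->; move: hpy; case: (H p); case: (K y) => //= _; rewrite ?mulr1n ?mulr0n; ring.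
Qed.

(** The admissible gaps are those after a letter of [A], and the first one if [H p]. The former
    realise each exponent below [count A u] once, the latter has exponent [count A u]. *)
Lemma gapsum_after H K A p u z :
  all (fun y => H y == A y) u -> all K u -> K z ->
  gapsum H K (fun _ b => count A b) p u z
  = (H p)%:R * q ^+ count A u + qint (count A u).
Proof.
elim: u p => [|y u IH] p /=.
  by move=> _ _ kz; rewrite gapsum_nil kz /= qint0 andbT addr0.
move=> /andP[/eqP hy hu] /andP[ky ku] kz; rewrite gapsum_cons /= ky andbT IH // hy.
by case: (A y); rewrite ?add1n ?add0n ?qintS ?mulr1n ?mulr0n; ring.
Qed.

(** The mirror image: the admissible gaps are those before a letter of [A], and the last one if
    [K z]. *)
Lemma gapsum_before H K A p u z :
  all (fun y => K y == A y) u -> all H u -> H p ->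
  gapsum H K (fun a _ => count A a) p u z
  = (K z)%:R * q ^+ count A u + qint (count A u).
Proof.
elim: u p => [|y u IH] p /=.
  by move=> _ _ hp; rewrite gapsum_nil hp /= qint0 addr0.
move=> /andP[/eqP ky ku] /andP[hy hu] hp; rewrite gapsum_cons /= hp ky gapsum_expD IH //.
by case: (A y); rewrite ?add1n ?add0n ?qintSl ?exprS ?expr0 ?mulr1n ?mulr0n; ring.
Qed.

End GapSums.

(** * Schedule numbers and the insertion of one letter *)

Definition ucount (X : seq letter) (i : nat) (f : pred nat) : nat :=
  count (fun d => [&& ~~ dc d, lv d == i & f (lb d)]) X.

(** The counterpart of [sched_num], with levels of a word in place of runs of the diagonal word. *)
Definition schedule (s : nat) (X : seq letter) (c : letter) : nat :=
  if (lv c < s) || dc c then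
    ucount X (lv c) (fun d => d < lb c) + ucount X (lv c).+1 (fun d => lb c < d)
  else if lv c == s then ucount X (lv c) (fun d => lb c < d) + 1
  else ucount X (lv c) (fun d => lb c < d) + ucount X (lv c).-1 (fun d => d < lb c).

(* [c] may be inserted after [d]: decorated letters come last, and undecorated ones
   come by increasing distance to [s], by decreasing labels in the levels >= s
   and by increasing labels in the levels < s. *)
Definition insertable (s : nat) (c d : letter) : bool :=
  (lb d != lb c) &&
  if dc c then true else
  ~~ dc d &&
  (if s < lv c then (lv d < lv c) || ((lv d == lv c) && (lb c < lb d))
   else if lv c < s then (lv c < lv d) || ((lv d == lv c) && (lb d < lb c))
   else (lv d == s) && (lb c < lb d)).

Lemma follows_trans_dec c p x : dc c -> follows p c -> follows c x -> follows p x.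
Proof. rewrite /follows => ->; case: (dc x); lia. Qed.

(** Climbs of one level do not compose in general. The insertion order prevents two in a row around
    an undecorated [c]: above [s] nothing present is higher than [c], below [s] nothing is lower,
    and at [s] everything has level [s]. *)
Lemma follows_trans N s c p x : lb c < N ->
  (p == marker N s) || insertable s c p && (lb p < N) -> (x == marker N s) || insertable s c x ->
  follows p c -> follows c x -> follows p x.
Proof.
move=> cN hp hx; case E: (dc c); first exact: follows_trans_dec.
move: hp hx; rewrite /insertable E.
case: x => xl [xb xd]; case: p => pl [pb pd]; case: c E cN => cl [cb cd].
rewrite /follows /marker /lv /lb /dc /= => -> cN.
case/orP => [/eqP[? ? ?]|hp]; case/orP => [/eqP[? ? ?]|hx]; subst;
  try (move: hp); try (move: hx);
  try (case: xd => //); try (case: pd => //); repeat (case: ifP => //); lia.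
Qed.

Lemma head_in (T : eqType) (z : T) (s : seq T) : (head z s == z) || (head z s \in s).
Proof. by case: s => [|x s] /=; rewrite ?eqxx ?mem_head ?orbT. Qed.

Lemma last_in (T : eqType) (z : T) (s : seq T) : (last z s == z) || (last z s \in s).
Proof. by have := mem_last z s; rewrite inE. Qed.

Lemma valid_ins N s c u j : lb c < N -> all (fun d => lb d < N) u ->
  all (insertable s c) u ->
  valid N s (ins j c u) =
  [&& valid N s u, follows (last (marker N s) (take j u)) c
    & follows c (head (marker N s) (drop j u))].
Proof.
move=> cN /allP hN /allP hu; rewrite /valid /=; apply: path_ins => p x hpc hcx ep ex.
apply: (@follows_trans N s c p x cN _ _ hpc hcx); rewrite ?ep ?ex.
  have /orP[->//|/mem_take pu] := last_in (marker N s) (take j u).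
  by rewrite (hu _ pu) (hN _ pu) orbT.
by have /orP[->//|/mem_drop/hu->] := head_in (marker N s) (drop j u); rewrite orbT.
Qed.

Lemma count_ucount2 (a : pred letter) X i f j g :
  {in X, forall d, nat_of_bool (a d) =
     [&& ~~ dc d, lv d == i & f (lb d)] + [&& ~~ dc d, lv d == j & g (lb d)] :> nat} ->
  count a X = ucount X i f + ucount X j g.
Proof.
rewrite /ucount; elim: X => [|x X IH] //= h.
rewrite (h x) ?mem_head // IH; last by move=> d dX; apply: h; rewrite inE dX orbT.
by lia.
Qed.

Section InsertionSum.
Variables (R : comNzRingType) (q : R).
Local Open Scope ring_scope.

(** Four cases: [c] decorated, or undecorated above, below or at level [s]. In each of them the
    attacks involving [c] come from one side of it only, so one of the gap sums applies. *)
Lemma insertion_sum N s c u : (lb c < N)%N ->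
  all (fun d => lb d < N)%N u -> all (insertable s c) u -> valid N s u ->
  \sum_(0 <= j < (size u).+1 | valid N s (ins j c u)) q ^+ nattacks (ins j c u)
  = q ^+ nattacks u * (q ^+ (dc c && (s <= lv c)%N) * qint q (schedule s u c)).
Proof.
move=> cN hN hu vu; set z := marker N s.
have E f : (forall j, nattacks (ins j c u) = nattacks u + f (take j u) (drop j u))%N ->
   \sum_(0 <= j < (size u).+1 | valid N s (ins j c u)) q ^+ nattacks (ins j c u)
   = q ^+ nattacks u * gapsum q (follows^~ c) (follows c) f z u z.
  move=> hf; rewrite big_mkcond mulr_sumr; apply: eq_bigr => j _.
  rewrite valid_ins // vu /= -/z hf.
  by case: (_ && _); rewrite ?mul1r ?mul0r ?mulr0 ?exprD.
have Ea : ~~ has (attacks c) u ->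
    forall j, nattacks (ins j c u) = (nattacks u + count (attacks^~ c) (take j u))%N.
  move=> h j; rewrite nattacks_ins [X in (_ + X)%N](_ : _ = 0)%N ?addn0 //.
  apply/eqP; rewrite -leqn0 leqNgt -has_count; apply: contra h => /hasP[x /mem_drop xu ax].
  by apply/hasP; exists x.
have Eb : ~~ has (attacks^~ c) u ->
    forall j, nattacks (ins j c u) = (nattacks u + count (attacks c) (drop j u))%N.
  move=> h j; rewrite nattacks_ins [X in (_ + X + _)%N](_ : _ = 0)%N ?addn0 //.
  apply/eqP; rewrite -leqn0 leqNgt -has_count; apply: contra h => /hasP[x /mem_take xu ax].
  by apply/hasP; exists x.
case Dc: (dc c).
  rewrite (E (fun a _ => count (attacks^~ c) a) (Ea _)); last by apply/hasPn => x _; rewrite /attacks Dc.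
  congr (_ * _).
  have := @gapsum_between _ q _ (follows^~ c) (follows c) (attacks^~ c) z u z.
  rewrite (_ : follows c z = (s <= lv c)%N); last first.
    by rewrite /follows /z /marker /lv /lb /= in cN *; lia.
  rewrite (_ : follows z c = (lv c < s)%N); last first.
    by rewrite /follows /z /marker Dc /lv /lb /= in cN *; lia.
  rewrite (_ : count (attacks^~ c) u = schedule s u c); last first.
    rewrite /schedule Dc orbT; apply: count_ucount2 => d /(allP hu).
    rewrite /attacks /insertable; case: (dc d) => /=; lia.
  move=> H; have {H} : gapsum q (follows^~ c) (follows c)
      (fun a _ => count (attacks^~ c) a) z u z
      + (~~ (s <= lv c)%N)%:R * q ^+ schedule s u c
      = (lv c < s)%N%:R + q * qint q (schedule s u c); first apply: H.
  - apply/allP => y /(allP hu); rewrite /insertable /attacks /follows Dc.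
    by case: (dc y) => /=; try case: ifP; lia.
  (* If [c] cannot follow [p], then [p] is on a lower level, or on the level of [c] with a larger
     label; whatever follows [p] can then follow [c]. *)
  - have := vu; rewrite /valid /= -/z; set v := rcons u z => pv.
    have cv : all (fun y => (lv y == lv c) ==> (lb y != lb c)) (z :: v).
      have cz : (lv z == lv c) ==> (lb z != lb c) by rewrite (gtn_eqF cN) implybT.
      rewrite /= /v all_rcons cz /=.
      by apply/allP => y /(allP hu) /andP[->]; rewrite implybT.
    elim: v (z) pv cv => [|y v IH] p //= /andP[py yv] /and3P[hp hy hv].
    rewrite IH //= ?hy ?hv // andbT.
    by move: py hp hy; rewrite /follows Dc; case: (dc y); lia.
  (* For [s <= lv c] the sum is [q] times the q-integer of [w], the schedule number of [c];
     otherwise [1 + q * qint q w = qint q w + q ^+ w], and the last power cancels. *)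
  case: leqP => h /=; rewrite ?mul0r ?addr0 ?add0r ?mul1r ?expr0 ?expr1 //.
  rewrite -qintSl qintS; exact: addIr.
have [h|h|h] := ltngtP s (lv c).
- rewrite andFb expr0 mul1r (E (fun _ b => count (attacks c) b) (Eb _)); last first.
    by apply/hasPn => x /(allP hu); rewrite /insertable /attacks Dc h; lia.
  congr (_ * _); rewrite gapsum_after.
  + rewrite (_ : follows z c = false) ?mul0r ?add0r; last first.
      by rewrite /follows /z /marker Dc /lv /lb /= in h cN *; lia.
    congr (qint _ _); rewrite /schedule Dc orbF ifN -?leqNgt 1?ltnW // ifN ?gtn_eqF //.
    apply: count_ucount2 => d /(allP hu); rewrite /insertable /attacks Dc h.
    by case: (dc d) => /=; lia.
  + apply/allP => d /(allP hu); rewrite /insertable /attacks /follows Dc h; lia.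
  + apply/allP => d /(allP hu); rewrite /insertable /follows Dc h.
    by case: (dc d) => /=; lia.
  + by rewrite /follows /z /marker /lv /lb /= in h cN *; lia.
- rewrite andFb expr0 mul1r (E (fun a _ => count (attacks^~ c) a) (Ea _)); last first.
    by apply/hasPn => x /(allP hu); rewrite /insertable /attacks Dc ltnNge ltnW //= h; lia.
  congr (_ * _); rewrite gapsum_before.
  + rewrite (_ : follows c z = false) ?mul0r ?add0r; last first.
      by rewrite /follows /z /marker /lv /lb /= in h cN *; lia.
    congr (qint _ _); rewrite /schedule Dc h /=.
    apply: count_ucount2 => d /(allP hu); rewrite /insertable /attacks Dc ltnNge ltnW //= h.
    by case: (dc d) => /=; lia.
  + apply/allP => d /(allP hu); rewrite /insertable /attacks /follows Dc ltnNge ltnW //= h.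
    by case: (dc d) => /=; lia.
  + apply/allP => d /(allP hu); rewrite /insertable /follows Dc ltnNge ltnW //= h; lia.
  + by rewrite /follows /z /marker Dc /lv /lb /= in h cN *; lia.
- rewrite andFb expr0 mul1r (E (fun _ b => count (attacks c) b) (Eb _)); last first.
    by apply/hasPn => x /(allP hu); rewrite /insertable /attacks Dc h ltnn; lia.
  congr (_ * _); rewrite gapsum_after.
  (* At level [s] the gap right after the marker is admissible too: it accounts for the [+ 1] in the
     schedule number. *)
  + rewrite (_ : follows z c = true) ?mul1r; last first.
      by rewrite /follows /z /marker Dc /lv /lb /= in h cN *; lia.
    rewrite addrC -qintS; congr (qint _ _).
    rewrite /schedule Dc h ltnn eqxx addn1; congr _.+1; apply: eq_in_count => d /(allP hu).
    by rewrite /insertable /attacks Dc h ltnn; case: (dc d) => /=; lia.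
  + apply/allP => d /(allP hu); rewrite /insertable /attacks /follows Dc h ltnn; lia.
  + apply/allP => d /(allP hu); rewrite /insertable /follows Dc h ltnn.
    by case: (dc d) => /=; lia.
  + by rewrite /follows /z /marker /lv /lb /= in h cN *; lia.
Qed.

End InsertionSum.

(** * The schedule formula *)

Lemma perm_ucount X Y i f : perm_eq X Y -> ucount X i f = ucount Y i f.
Proof. by move=> /permP; apply. Qed.

Lemma perm_schedule s X Y c : perm_eq X Y -> schedule s X c = schedule s Y c.
Proof. by move=> h; rewrite /schedule !(perm_ucount _ _ h). Qed.

(** Schedule numbers count only undecorated letters that come earlier in the insertion order, and
    [c] comes after [d]. *)
Lemma schedule_cons s c X d : insertable s c d -> schedule s (c :: X) d = schedule s X d.
Proof.
rewrite /insertable /schedule /ucount /=; case: (dc c) => //=.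
by case: (dc d) => //=; rewrite ?orbF; repeat case: ifP; lia.
Qed.

Lemma schedule_head s c X : schedule s (c :: X) c = schedule s X c.
Proof.
by rewrite /schedule /ucount /= !ltnn !andbF !add0n.
Qed.

Lemma insertable_exists s X : X != [::] -> uniq (map lb X) ->
  exists c X', perm_eq X (c :: X') /\ all (insertable s c) X'.
Proof.
have [M hM] : exists M, all (fun x => (lv x <= M) && (lb x <= M)) X.
  elim: X => [|x X [M hM]]; first by exists 0.
  exists (M + lv x + lb x) => /=; apply/andP; split; first lia.
  by apply: sub_all hM => y; lia.
(* Sort keys that put the letter to be inserted last at the front: decorated letters, then the
   levels above [s] from the top, then the levels up to [s] from the bottom. The bound [M] keeps the
   truncated subtractions faithful. *)
pose k1 x := if dc x then 0 else if s < lv x then (M - lv x).+1 else M.+2 + lv x.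
pose k2 x := if lv x < s then M - lb x else lb x.
pose le x y := (k1 x < k1 y) || ((k1 x == k1 y) && (k2 x <= k2 y)).
have le_total : total le by move=> x y; rewrite /le; lia.
have le_trans : transitive le by move=> x y z; rewrite /le; lia.
move=> X0 uX; have pX : perm_eq X (sort le X) by rewrite perm_sym perm_sort.
have := sort_sorted le_total X; case E: (sort le X) pX => [|c X'] pX.
  by move: X0; rewrite -size_eq0 (perm_size pX).
move=> /= /(order_path_min le_trans)/allP hc; exists c, X'; split=> //.
have: uniq (map lb (c :: X')) by rewrite -(perm_uniq (perm_map lb pX)).
move=> /= /andP[cX' _]; apply/allP => d dX'.
have hd : lb d != lb c by apply: contraNneq cX' => <-; apply: map_f.
have /andP[M1 M2] : (lv d <= M) && (lb d <= M).
  by apply: (allP hM); rewrite (perm_mem pX) inE dX' orbT.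
have /andP[M3 M4] : (lv c <= M) && (lb c <= M).
  by apply: (allP hM); rewrite (perm_mem pX) mem_head.
move: (hc d dX'); rewrite /insertable hd /le /k1 /k2 /=.
by case: (dc c) => //; case: (dc d) => //=; repeat case: ifP; lia.
Qed.

Lemma perm_perms (X Y : seq letter) : uniq X -> perm_eq X Y -> perm_eq (perms X) (perms Y).
Proof.
move=> uX pXY; apply: uniq_perm; rewrite ?perms_uniq -?(perm_uniq pXY) // => u.
by rewrite !mem_perms (permPr pXY).
Qed.

(** Induction on the number of letters: the last letter in the insertion order contributes the
    factor of [insertion_sum] and does not affect the other schedule numbers. *)
Theorem schedule_formula (R : comNzRingType) (q : R) N s X :
  uniq (map lb X) -> all (fun c => lb c < N) X ->
  (\sum_(u <- perms X | valid N s u) q ^+ nattacks u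
   = q ^+ count (fun c => dc c && (s <= lv c)%N) X
     * \prod_(c <- X) qint q (schedule s X c))%R.
Proof.
have [m] := ubnP (size X); elim: m X => // m IH X Xm uX NX.
have [->|X0] := eqVneq X [::].
  rewrite /= big_cons !big_nil /valid /= /follows /marker /lv /lb /= eqxx leqnn orbT.
  by rewrite !expr0 mulr1 addr0.
have [c [X' [pX iX]]] := insertable_exists s X0 uX.
have uXX : uniq X by apply: map_uniq uX.
rewrite (perm_big _ (perm_perms uXX pX)) (permP pX) (perm_big _ pX) /=.
under [in RHS]eq_bigr do rewrite (perm_schedule _ _ pX).
rewrite big_flatten big_map big_cons schedule_head.
have {}NX : all (fun c => lb c < N) (c :: X') by rewrite -(perm_all _ pX).
have /andP[Nc NX'] := NX.
have uX' : uniq (map lb X').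
  by move: uX; rewrite (perm_uniq (perm_map lb pX)) => /= /andP[].
have E : (\sum_(j <- perms X') \sum_(i <- inserts c j | valid N s i) q ^+ nattacks i
  = \sum_(u <- perms X' | valid N s u) q ^+ nattacks u
      * (q ^+ (dc c && (s <= lv c)%N) * qint q (schedule s X' c)))%R.
  rewrite [RHS]big_mkcond big_seq [RHS]big_seq; apply: eq_bigr => u.
  rewrite mem_perms => pu.
  have Nu : all (fun d => lb d < N) u by rewrite (perm_all _ pu).
  have iu : all (insertable s c) u by rewrite (perm_all _ pu).
  rewrite /inserts big_map -[(size u).+1]subn0; case: ifPn => vu.
    by rewrite (insertion_sum q Nc Nu iu vu) (perm_schedule _ _ pu).
  by apply: big1 => j; rewrite valid_ins // (negbTE vu).
rewrite E -big_distrl /= IH //; last by rewrite -ltnS (leq_trans _ Xm) // ltnS (perm_size pX).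
rewrite exprD [in RHS]big_seq.
under [in RHS]eq_bigr => d dX do rewrite (schedule_cons _ (allP iX d dX)).
by rewrite -big_seq; ring.
Qed.

(** * Words all of whose schedule numbers are odd *)

Definition above (c : nat) (l : seq nat) : nat := count (fun d => c < d) l.
Definition below (c : nat) (l : seq nat) : nat := count (fun d => d < c) l.

(* [lo] and [up] are the undecorated labels of two consecutive levels; the sums are
   the schedule numbers of [c] when both levels are >= s, resp. <= s. *)
Definition up_cond (Q : pred nat) (lo up : seq nat) : Prop :=
  {in up, forall c, Q (above c up + below c lo)}.
Definition dn_cond (Q : pred nat) (lo up : seq nat) : Prop :=
  {in lo, forall c, Q (below c lo + above c up)}.

Lemma perm_above c l l' : perm_eq l l' -> above c l = above c l'.
Proof. by move/permP; apply. Qed.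

Lemma perm_below c l l' : perm_eq l l' -> below c l = below c l'.
Proof. by move/permP; apply. Qed.

Lemma above_sorted c l : path gtn c l -> forall v, c <= v -> above v l = 0.
Proof.
move=> /(order_path_min (fun x y z h1 h2 => ltn_trans h2 h1))/allP h v cv.
by apply/eqP; rewrite -leqn0 leqNgt -has_count; apply/hasPn => d /h /=; lia.
Qed.

Lemma below_sorted c l : path ltn c l -> forall v, v <= c -> below v l = 0.
Proof.
move=> /(order_path_min ltn_trans)/allP h v cv.
by apply/eqP; rewrite -leqn0 leqNgt -has_count; apply/hasPn => d /h /=; lia.
Qed.

Lemma uniq_desc (l : seq nat) : uniq l -> exists2 l', perm_eq l l' & sorted gtn l'.
Proof.
move=> ul; exists (rev (sort leq l)); first by rewrite perm_sym perm_rev perm_sort.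
by rewrite rev_sorted (@eq_sorted _ _ ltn) // ltn_sorted_uniq_leq sort_uniq ul sort_sorted.
Qed.

Lemma uniq_asc (l : seq nat) : uniq l -> exists2 l', perm_eq l l' & sorted ltn l'.
Proof.
move=> ul; exists (sort leq l); first by rewrite perm_sym perm_sort.
by rewrite ltn_sorted_uniq_leq sort_uniq ul sort_sorted.
Qed.

(** The second largest label would have schedule number 2. *)
Lemma level_odd l : uniq l -> {in l, forall c, odd (above c l + 1)} -> size l <= 1.
Proof.
move=> /uniq_desc[l' pl sl] h; rewrite (perm_size pl).
case: l' pl sl => [|x [|y l']] // pl /= /andP[xy yl].
have := h y; rewrite (perm_mem pl) !inE eqxx orbT => /(_ isT).
by rewrite (perm_above _ pl) /above /= xy ltnn -/(above y l') (above_sorted yl) //=.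
Qed.

(** For the largest labels [x > y > z] of [up] the first counts are 0, 1, 2, and the second ones
    decrease weakly from at most 2. Oddness forces the second count to be 1 at [x], hence 0 at [y],
    and leaves none for [z]. *)
Lemma up_odd lo up : uniq up -> size lo <= 2 -> up_cond odd lo up ->
  up_cond (pred1 1) lo up /\ size up <= 2.
Proof.
move=> /uniq_desc[l pl sl] slo h.
have {}h : up_cond odd lo l.
  by move=> c cl; rewrite -(perm_above _ pl); apply: h; rewrite (perm_mem pl).
suff [h1 h2] : up_cond (pred1 1) lo l /\ size l <= 2.
  rewrite (perm_size pl); split=> // c cu; rewrite (perm_above _ pl).
  by apply: h1; rewrite -(perm_mem pl).
have {}h : all (fun c => odd (above c l + below c lo)) l by apply/allP.
suff [h1 h2] : all (fun c => above c l + below c lo == 1) l /\ size l <= 2.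
  by split=> // c; apply: (allP h1).
rewrite /above /below in h *.
case: lo slo h => [|a [|b []]] // _; case: l pl sl => [|x [|y [|z l]]] pl //=;
  rewrite ?andbT ?ltnn; try (split=> //; lia);
  move=> /and3P[xy yz zl]; have := above_sorted zl (leqnn z);
  have := above_sorted zl (ltnW yz); have := above_sorted zl (ltnW (ltn_trans yz xy));
  rewrite /above /= in xy yz *; lia.
Qed.

Lemma dn_odd lo up : uniq lo -> size up <= 2 -> dn_cond odd lo up ->
  dn_cond (pred1 1) lo up /\ size lo <= 2.
Proof.
move=> /uniq_asc[l pl sl] sup h.
have {}h : dn_cond odd l up.
  by move=> c cl; rewrite -(perm_below _ pl); apply: h; rewrite (perm_mem pl).
suff [h1 h2] : dn_cond (pred1 1) l up /\ size l <= 2.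
  rewrite (perm_size pl); split=> // c cu; rewrite (perm_below _ pl).
  by apply: h1; rewrite -(perm_mem pl).
have {}h : all (fun c => odd (below c l + above c up)) l by apply/allP.
suff [h1 h2] : all (fun c => below c l + above c up == 1) l /\ size l <= 2.
  by split=> // c; apply: (allP h1).
rewrite /above /below in h *.
case: up sup h => [|a [|b []]] // _; case: l pl sl => [|x [|y [|z l]]] pl //=;
  rewrite ?andbT ?ltnn; try (split=> //; lia);
  move=> /and3P[xy yz zl]; have := below_sorted zl (leqnn z);
  have := below_sorted zl (ltnW yz); have := below_sorted zl (ltnW (ltn_trans xy yz));
  rewrite /below /= in xy yz *; lia.
Qed.

Lemma up_condP Q lo up : reflect (up_cond Q lo up) (all (fun c => Q (above c up + below c lo)) up).
Proof. exact: allP. Qed.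

Lemma dn_condP Q lo up : reflect (dn_cond Q lo up) (all (fun c => Q (below c lo + above c up)) lo).
Proof. exact: allP. Qed.

(** Both conditions express the same interlacing [y <= a < x <= b] of the lower labels [a < b] and
    the upper labels [y < x], where [b] and [y] may be absent. *)
Lemma up_dn lo up : uniq lo -> uniq up -> 0 < size lo <= 2 -> 0 < size up <= 2 ->
  up_cond (pred1 1) lo up <-> dn_cond (pred1 1) lo up.
Proof.
move=> ulo uup slo sup; split=> [/up_condP h|/dn_condP h]; [apply/dn_condP|apply/up_condP];
  case: lo ulo slo h => [|a [|b []]] //; case: up uup sup => [|x [|y []]] //=;
  rewrite /above /below /= ?inE; lia.
Qed.

(** Above an empty level the largest label would have number 0. *)
Lemma up_nil up : uniq up -> up_cond (pred1 1) [::] up -> up = [::].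
Proof.
move=> /uniq_desc[l pl sl] h; apply/eqP; rewrite -size_eq0 (perm_size pl) size_eq0.
case: l pl sl => // x l pl /= xl.
have := h x; rewrite (perm_mem pl) mem_head => /(_ isT).
by rewrite (perm_above _ pl) /= /above /= ltnn -/(above x l) (above_sorted xl).
Qed.

Lemma dn_nil lo : uniq lo -> dn_cond (pred1 1) lo [::] -> lo = [::].
Proof.
move=> /uniq_asc[l pl sl] h; apply/eqP; rewrite -size_eq0 (perm_size pl) size_eq0.
case: l pl sl => // x l pl /= xl.
have := h x; rewrite (perm_mem pl) mem_head => /(_ isT).
by rewrite (perm_below _ pl) /= /below /= ltnn -/(below x l) (below_sorted xl).
Qed.

(** The sum is at most 4, and the value 3 would take both labels of one level and one of the other,
    which interlacing excludes. *)
Lemma dec_odd c lo up : uniq lo -> uniq up -> size lo <= 2 -> size up <= 2 ->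
  up_cond (pred1 1) lo up \/ dn_cond (pred1 1) lo up ->
  odd (below c lo + above c up) -> below c lo + above c up = 1.
Proof.
move=> ulo uup slo sup [/up_condP h|/dn_condP h];
  case: lo ulo slo h => [|a [|b []]] //; case: up uup sup => [|x [|y []]] //=;
  rewrite /above /below /= ?inE; lia.
Qed.

(** * Schedule conditions level by level *)

Definition ulevel (X : seq letter) (i : nat) : seq nat :=
  [seq lb d | d <- X & ~~ dc d && (lv d == i)].

Lemma ucountE X i f : ucount X i f = count f (ulevel X i).
Proof.
by rewrite /ulevel count_map count_filter; apply: eq_count => d /=; case: (f _); case: (dc d); case: (_ == _).
Qed.

Lemma ulevel_uniq X i : uniq (map lb X) -> uniq (ulevel X i).
Proof. by apply: subseq_uniq; apply/map_subseq/filter_subseq. Qed.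

Lemma ulevelP X i v :
  reflect (exists c, [/\ c \in X, ~~ dc c, lv c = i & lb c = v]) (v \in ulevel X i).
Proof.
apply: (iffP mapP) => [[c]|[c [cX dc_ lvc lbc]]].
  by rewrite mem_filter => /andP[/andP[d /eqP l] cX] ->; exists c.
by exists c; rewrite // mem_filter dc_ lvc eqxx.
Qed.

(** Stated for any predicate [Q], to serve both for odd schedule numbers and for those equal to
    1. *)
Lemma scheduleP (Q : pred nat) s X :
  {in X, forall c, Q (schedule s X c)} <->
  [/\ forall i, i < s -> dn_cond Q (ulevel X i) (ulevel X i.+1),
      {in ulevel X s, forall c, Q (above c (ulevel X s) + 1)},
      forall i, s <= i -> up_cond Q (ulevel X i) (ulevel X i.+1)
    & {in X, forall c, dc c ->
        Q (below (lb c) (ulevel X (lv c)) + above (lb c) (ulevel X (lv c).+1))}].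
Proof.
rewrite /schedule /dn_cond /up_cond /above /below; split.
  move=> h; split.
  - move=> i si v /ulevelP[c [cX dc_ lvc lbc]].
    by have := h c cX; rewrite lvc si lbc /= !ucountE.
  - move=> v /ulevelP[c [cX dc_ lvc lbc]].
    by have := h c cX; rewrite lvc ltnn eqxx lbc (negbTE dc_) /= !ucountE.
  - move=> i si v /ulevelP[c [cX dc_ lvc lbc]].
    have := h c cX; rewrite lvc lbc (negbTE dc_) orbF ifN; last by rewrite -leqNgt leqW.
    by rewrite ifN ?gtn_eqF //= !ucountE.
  - by move=> c cX dcc; have := h c cX; rewrite dcc orbT !ucountE.
move=> [h1 h2 h3 h4] c cX; have := h4 c cX; rewrite !ucountE.
case dcc: (dc c); first by rewrite orbT; apply.
have cU : lb c \in ulevel X (lv c) by apply/ulevelP; exists c; rewrite dcc.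
rewrite orbF => _; case: ltngtP => cs.
- exact: h1.
- by have := h3 (lv c).-1; rewrite prednK ?(leq_ltn_trans _ cs) // -ltnS prednK ?(leq_ltn_trans _ cs) //; apply.
- by rewrite cs; apply: h2; rewrite -cs.
Qed.

Definition all_one s X : Prop := {in X, forall c, schedule s X c == 1}.
Definition all_odd s X : Prop := {in X, forall c, odd (schedule s X c)}.

Lemma all_one_odd s X : all_one s X -> all_odd s X.
Proof. by move=> h c /h/eqP->. Qed.

(** Level [s] has at most one undecorated letter; from there [up_odd] and [dn_odd] carry the bound 2
    and the value 1 upwards and downwards. *)
Lemma all_odd_one s X : X != [::] -> uniq (map lb X) -> all_odd s X ->
  [/\ all_one s X, size (ulevel X s) = 1 & forall i, size (ulevel X i) <= 2].
Proof.
move=> X0 uX /scheduleP[h1 h2 h3 h4].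
have U i : uniq (ulevel X i) by apply: ulevel_uniq.
have s1 : size (ulevel X s) <= 1 by apply: level_odd.
have s2 : size (ulevel X s) <= 2 by apply: leqW.
have hup j : up_cond (pred1 1) (ulevel X (s + j)) (ulevel X (s + j).+1)
             /\ size (ulevel X (s + j)) <= 2.
  elim: j => [|j [_ IH]].
    rewrite addn0; split=> //.
    by have [] := up_odd (U s.+1) s2 (h3 s (leqnn s)).
  have [_ IH2] := up_odd (U _) IH (h3 _ (leq_addr _ _)).
  rewrite addnS; split=> //.
  by have [] := up_odd (U _) IH2 (h3 _ (leqW (leq_addr _ _))).
have hdn j : j <= s -> (0 < j -> dn_cond (pred1 1) (ulevel X (s - j)) (ulevel X (s - j).+1))
             /\ size (ulevel X (s - j)) <= 2.
  elim: j => [|j IH] js; first by rewrite subn0; split.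
  have [_ IH2] := IH (ltnW js).
  have e : (s - j.+1).+1 = s - j by lia.
  by have := h1 (s - j.+1); rewrite e => /(_ ltac:(lia)) /(dn_odd (U _) IH2)[].
have hup' i : s <= i -> up_cond (pred1 1) (ulevel X i) (ulevel X i.+1).
  by move=> si; have [] := hup (i - s); rewrite subnKC.
have hdn' i : i < s -> dn_cond (pred1 1) (ulevel X i) (ulevel X i.+1).
  by move=> si; have [] := hdn (s - i) (leq_subr _ _); rewrite subKn ?(ltnW si) // subn_gt0 => /(_ si).
have sz i : size (ulevel X i) <= 2.
  have [si|si] := leqP s i; first by have [] := hup (i - s); rewrite subnKC.
  by have [] := hdn (s - i) (leq_subr _ _); rewrite subKn ?(ltnW si).
have hd : {in X, forall c, dc c ->
   below (lb c) (ulevel X (lv c)) + above (lb c) (ulevel X (lv c).+1) == 1}.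
  move=> c cX dcc; apply/eqP/dec_odd => //; last exact: h4.
  by have [si|si] := leqP s (lv c); [left; apply: hup'|right; apply: hdn'].
(* Otherwise [up_nil] and [dn_nil] empty all levels, so every letter is decorated and has schedule
   number 0. *)
have s0 : size (ulevel X s) = 1.
  apply/eqP; rewrite eqn_leq s1 lt0n size_eq0; apply/eqP => Us.
  have Ez i : ulevel X i = [::].
    have [si|si] := leqP s i.
      elim: i si => [|i IH]; first by rewrite leqn0 => /eqP<-.
      rewrite leq_eqVlt => /orP[/eqP<-//|]; rewrite ltnS => si.
      by apply: up_nil => //; rewrite -(IH si); apply: hup'.
    have [j ->] : exists j, i = s - j by exists (s - i); lia.
    elim: j => [|j IH]; first by rewrite subn0.
    have [js|js] := leqP s j; first by rewrite (_ : s - j.+1 = s - j) //; lia.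
    apply: dn_nil => //; rewrite -IH (_ : s - j = (s - j.+1).+1); last lia.
    by apply: hdn'; lia.
  case: X X0 hd Ez {uX U h1 h2 h3 h4 hup hdn hup' hdn' sz s1 s2 Us} => // c X _ hd Ez.
  have := hd c (mem_head _ _); rewrite !Ez /=.
  case dcc: (dc c); first by move=> /(_ isT).
  have : lb c \in ulevel (c :: X) (lv c) by apply/ulevelP; exists c; rewrite mem_head dcc.
  by rewrite Ez.
split=> //; apply/(scheduleP (pred1 1)); split=> //.
move=> c; case: (ulevel X s) s0 => [|v []] // _; rewrite inE => /eqP->.
by rewrite /above /= ltnn.
Qed.

(** Only the levels between [s] and [s'] change the type of their condition. None of them is empty,
    as emptiness would spread from there to [s']; so [up_dn] converts one type into the other. *)
Lemma all_one_move s s' X : X != [::] -> uniq (map lb X) -> all_one s X ->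
  size (ulevel X s') = 1 -> all_one s' X.
Proof.
move=> X0 uX h1 s'1; have [_ s1 sz] := all_odd_one X0 uX (all_one_odd h1).
move: h1 => /(scheduleP (pred1 1))[h1 h2 h3 h4].
have U i : uniq (ulevel X i) by apply: ulevel_uniq.
apply/(scheduleP (pred1 1)); split=> //.
- move=> i is'; have [si|si] := leqP s i; last exact: h1.
  have pos j : s <= j <= s' -> 0 < size (ulevel X j).
    move=> /andP[sj js']; rewrite lt0n size_eq0; apply/eqP => Uj.
    have Ez m : ulevel X (j + m) = [::].
      elim: m => [|m IH]; first by rewrite addn0.
      by rewrite addnS; apply: up_nil => //; rewrite -IH; apply: h3; lia.
    by have := Ez (s' - j); rewrite subnKC // => E; rewrite E in s'1.
  by apply/up_dn; rewrite ?sz ?pos //; try lia; apply: h3.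
- move=> c; case: (ulevel X s') s'1 => [|v []] // _; rewrite inE => /eqP->.
  by rewrite /above /= ltnn.
- move=> i s'i; have [si|si] := leqP s i; first exact: h3.
  have pos j : s' <= j <= s -> 0 < size (ulevel X j).
    move=> /andP[sj js']; rewrite lt0n size_eq0; apply/eqP => Uj.
    have Ez m : ulevel X (j - m) = [::].
      elim: m => [|m IH]; first by rewrite subn0.
      have [mj|mj] := leqP j m; first by rewrite (_ : j - m.+1 = j - m) //; lia.
      apply: dn_nil => //; rewrite -IH (_ : j - m = (j - m.+1).+1); last lia.
      by apply: h1; lia.
    by have := Ez (j - s'); rewrite subKn // => E; rewrite E in s'1.
  by apply/up_dn; rewrite ?sz ?pos //; try lia; apply: h1.
Qed.

(** * Signed sums and cuts *)

Lemma qintN1 w : qint (-1 : int)%R w = (odd w)%:R%R.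
Proof.
elim: w => [|w IH]; first by rewrite qint0.
by rewrite qintS IH -signr_odd /=; case: (odd w).
Qed.

Lemma qint1 w : qint (1 : int)%R w = w%:R%R.
Proof.
by elim: w => [|w IH]; rewrite ?qint0 // qintS IH expr1n natr1.
Qed.

Lemma prod_natb (T : Type) (a : pred T) (X : seq T) :
  (\prod_(c <- X) (a c)%:R = (all a X)%:R :> int)%R.
Proof.
by elim: X => [|c X IH]; rewrite ?big_nil // big_cons IH -natrM mulnb.
Qed.

Section Counting.
Variables (N : nat) (X : seq letter).
Hypotheses (X0 : X != [::]) (uX : uniq (map lb X)) (NX : all (fun c => lb c < N) X).
Local Open Scope ring_scope.

Definition undecorated_below (s : nat) (u : seq letter) : nat :=
  count (fun c => ~~ dc c && (lv c < s)%N) u.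

(** Has the parity of [dinv]: the decorations are added instead of subtracted, to stay in [nat]. *)
Definition sign_exp (s : nat) (u : seq letter) : nat :=
  (nattacks u + count (fun c => (lv c < s)%N) u + count dc u)%N.

(** At -1 a q-integer is the parity of its argument. In the exponent the decorated letters cancel
    modulo 2, both below [s] and from [s] on. *)
Lemma signed_sum s :
  \sum_(u <- perms X | valid N s u) (-1) ^+ sign_exp s u
  = (-1) ^+ undecorated_below s X * (all (fun c => odd (schedule s X c)) X)%:R :> int.
Proof.
pose m := (count (fun c => (lv c < s)%N) X + count dc X)%N.
have -> : \sum_(u <- perms X | valid N s u) (-1) ^+ sign_exp s u =
   (-1) ^+ m * \sum_(u <- perms X | valid N s u) (-1) ^+ nattacks u :> int.
  rewrite mulr_sumr big_seq_cond [RHS]big_seq_cond; apply: eq_bigr => u.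
  rewrite mem_perms => /andP[/permP pu _].
  by rewrite /sign_exp !pu -exprD; congr (_ ^+ _); rewrite -addnA addnC.
rewrite schedule_formula //.
under eq_bigr do rewrite qintN1.
rewrite prod_natb mulrA -exprD; congr (_ * _).
rewrite -signr_odd -[RHS]signr_odd; congr (_ ^+ _); congr nat_of_bool.
rewrite /m /undecorated_below; elim: X => [|c Y IH] //=.
by case: (dc c) => /=; case: (leqP s (lv c)) => /=; lia.
Qed.

(** The sum telescopes: each term is the increment of the parity of [undecorated_below], which only
    levels with exactly one undecorated letter change. *)
Lemma level_sum L : (forall i, size (ulevel X i) <= 2)%N ->
  \sum_(0 <= s < L) (-1) ^+ undecorated_below s X * (size (ulevel X s) == 1%N)%:R
  = (odd (undecorated_below L X))%:R :> int.
Proof.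
move=> sz; have b0 : undecorated_below 0 X = 0%N.
  by rewrite /undecorated_below (eq_count (a2 := pred0)) ?count_pred0 // => c /=; rewrite andbF.
have bS s : undecorated_below s.+1 X = (undecorated_below s X + size (ulevel X s))%N.
  rewrite /undecorated_below /ulevel size_map size_filter.
  by elim: X => [|c Y IH] //=; case: (dc c) => /=; lia.
transitivity ((odd (undecorated_below L X))%:R - (odd (undecorated_below 0 X))%:R : int).
  rewrite -(@telescope_sumr int 0 L (fun s => (odd (undecorated_below s X))%:R)) //.
  apply: eq_bigr => s _; rewrite bS -signr_odd oddD.
  by case: (size _) (sz s) => [|[|[|]]] //=; case: (odd (undecorated_below s X)).
by rewrite b0 subr0.
Qed.

Lemma undecorated_below_all L : all (fun c => (lv c < L)%N) X ->
  undecorated_below L X = count (predC dc) X.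
Proof. by move=> /allP h; apply: eq_in_count => c /h ->; rewrite andbT. Qed.

(** By [all_one_move] the levels [s] with a nonzero sum are those with a single undecorated letter,
    as in [level_sum]. *)
Lemma signed_sum_all_one L s0 : all (fun c => (lv c < L)%N) X -> all_one s0 X ->
  \sum_(0 <= s < L) \sum_(u <- perms X | valid N s u) (-1) ^+ sign_exp s u
  = (odd (count (predC dc) X))%:R :> int.
Proof.
move=> hL h1; have [_ _ sz] := all_odd_one X0 uX (all_one_odd h1).
rewrite -(undecorated_below_all hL) -level_sum //; apply: eq_bigr => s _.
rewrite signed_sum; congr (_ * _%:R); congr nat_of_bool.
apply/allP/eqP => [h|h]; first by have [] := all_odd_one X0 uX h.
exact: all_one_odd (all_one_move X0 uX h1 h).
Qed.

Lemma signed_sum_not_one L : (forall s, ~ all_one s X) ->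
  \sum_(0 <= s < L) \sum_(u <- perms X | valid N s u) (-1) ^+ sign_exp s u = 0 :> int.
Proof.
move=> h; apply: big1 => s _; rewrite signed_sum; case: allP; rewrite ?mulr0 //.
by move=> /(all_odd_one X0 uX)[/h].
Qed.

(** The schedule formula at q = 1. *)
Lemma count_valid s : ((count (valid N s) (perms X))%:R
  = \prod_(c <- X) (schedule s X c)%:R :> int).
Proof.
have := schedule_formula (1 : int) s uX NX.
rewrite expr1n mul1r; under [in X in _ = X -> _]eq_bigr do rewrite qint1.
move=> <-; rewrite -sum1_count natr_sum; apply: eq_bigr => u _; rewrite expr1n //.
Qed.

Lemma all_one_count s : all_one s X -> count (valid N s) (perms X) = 1%N.
Proof.
move=> h; have := count_valid s; rewrite big_seq big1 => [/eqP|c /h/eqP->//].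
by rewrite (@eqr_nat int _ 1) => /eqP.
Qed.

Lemma all_one_exists s : all_one s X -> exists2 u, perm_eq u X & valid N s u.
Proof.
move=> h; have : has (valid N s) (perms X) by rewrite has_count all_one_count.
by move=> /hasP[u]; rewrite mem_perms; exists u.
Qed.

Lemma all_one_unique s u v : all_one s X -> perm_eq u X -> perm_eq v X ->
  valid N s u -> valid N s v -> u = v.
Proof.
move=> h pu pv vu vv; have := all_one_count h; rewrite -size_filter.
have: u \in filter (valid N s) (perms X) by rewrite mem_filter vu mem_perms.
have: v \in filter (valid N s) (perms X) by rewrite mem_filter vv mem_perms.
by case: filter => [|w []] //; rewrite !inE => /eqP-> /eqP->.
Qed.

End Counting.

Lemma validE N s x u : all (fun d => lb d < N) (x :: u) ->
  valid N s (x :: u) =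
  [&& (lv x < s) || ((lv x == s) && ~~ dc x), path follows x u & s <= lv (last x u)].
Proof.
move=> hN; rewrite /valid /= rcons_path; congr [&& _, _ & _].
  have xN : lb x < N by case/andP: hN.
  by rewrite /follows /marker /lv /lb /dc /= in xN *; case: (x.2.2); lia.
have: lb (last x u) < N by apply: (allP hN) (mem_last x u).
by rewrite /follows /marker /lv /lb /dc /=; lia.
Qed.

Lemma valid_le N N' s u : all (fun d => lb d < N) u -> N <= N' -> valid N' s u = valid N s u.
Proof.
case: u => [|x u] hN NN'.
  by rewrite /valid /= /follows /marker /lv /lb /= eqxx !leqnn.
by rewrite !validE //; apply: sub_all hN => d dN; apply: leq_trans NN'.
Qed.

(* Cutting at level [s'] amounts to inserting a second marker, i.e. a decorated
   letter, and removing the first one. *)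
Lemma cut_exists N s s' u : all (fun d => lb d < N) u -> valid N s u ->
  0 < size (ulevel u s') ->
  exists u1 u2, [/\ u = u1 ++ u2, valid N s' (u2 ++ u1),
    s' <= lv (last (marker N s) u1) & lv (head (marker N s) u2) <= s'].
Proof.
(* The new marker [c] has label [N], above all labels of [u]; the old one is raised to [N.+1] to
   leave room for it. *)
move=> hN vu hs'; pose c : letter := (s', (N, true)).
have hN' : all (fun d => lb d < N.+1) u by apply: sub_all hN => d; apply: leqW.
have iu : all (insertable s c) u.
  by apply: sub_all hN => d dN; rewrite /insertable /c {2}/lb /= (ltn_eqF dN).
have cN : lb c < N.+1 by [].
have vu' : valid N.+1 s u by rewrite (valid_le s hN).
(* At q = 1 this counts the valid insertions of [c]. Their number is the schedule number of [c],
   positive because the undecorated labels of level [s'] are all below [N]. *)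
have := insertion_sum (1 : int)%R cN hN' iu vu'.
rewrite qint1 !expr1n !mul1r.
have [/hasP[j _ vj] _|/hasPn none] :=
    boolP (has (fun j => valid N.+1 s (ins j c u)) (iota 0 (size u).+1)); last first.
  rewrite big1_seq => [/esym/eqP|j /andP[vj]]; last first.
    by rewrite /index_iota subn0 => /none; rewrite vj.
  rewrite pnatr_eq0 /schedule orbT !ucountE addn_eq0 => /andP[/eqP z _].
  rewrite [lv c]/= [lb c]/= in z.
  case E: (ulevel u s') hs' z => [|v l] // _.
  have /ulevelP[d [du _ _ <-]] : v \in ulevel u s' by rewrite E mem_head.
  by rewrite /= (allP hN d du).
exists (take j u), (drop j u).
have := vj; rewrite valid_ins // => /and3P[_ hp hx].
split; first by rewrite cat_take_drop.
(* Rotate the cyclic word to start at [c], then drop the old marker, which is decorated, by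
   transitivity. *)
- have : cycle follows (c :: drop j u ++ marker N.+1 s :: take j u).
    move: vj; rewrite /valid -(rot_cycle (size (marker N.+1 s :: take j u))).
    by rewrite /ins -[_ :: take _ _ ++ _]cat_cons rot_size_cat.
  rewrite /valid -[marker N s']/c /= !rcons_cat !cat_path /=.
  case: (take j u) => [|y v] /=; rewrite ?andbT => /and3P[-> h1 h2] /=.
    exact: follows_trans_dec h1 h2.
  by case/andP: h2 => h2 ->; rewrite (follows_trans_dec _ h1 h2).
- move: hp; rewrite /follows /c /=; case: (take j u) => [|y v] /=;
    rewrite /marker /lv /lb /=; lia.
- have : all (fun d => lb d < N) (drop j u) by apply/allP => d /mem_drop/(allP hN).
  move: hx; rewrite /follows /c /=; case: (drop j u) => [|y v] /=;
    rewrite /marker /lv /lb /dc /=; first lia.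
  by case: (y.2.2); lia.
Qed.

(** * From lattice paths to words *)

(** The area word zipped with the letters, computed by recursion from a starting height so that it
    behaves well under concatenation. *)
Fixpoint heights (h : int) (P : lpath) : seq (int * (nat * bool)) :=
  match P with
  | [::] => [::]
  | None :: P' => heights (h - 1)%R P'
  | Some x :: P' => (h, x) :: heights (h + 1)%R P'
  end.

Lemma north_pos_cons x P :
  north_pos (x :: P) = (if is_north x then [:: 0] else [::]) ++ map succn (north_pos P).
Proof.
rewrite /north_pos /= -[1]/(1 + 0) iotaDl filter_map.
by case: (is_north x).
Qed.

Lemma columns_cons x P : columns (x :: P) =
  (if is_north x then [:: 0] else [::]) ++ map (addn (is_east x)) (columns P).
Proof.
by rewrite /columns north_pos_cons map_cat -!map_comp; case: (is_north x).
Qed.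

Lemma area_word_cons x P : area_word (x :: P) =
  (if is_north x then [:: 0%R] else [::])
  ++ map (fun a => a + (if is_north x then 1 else -1))%R (area_word P).
Proof.
rewrite /area_word north_pos_cons map_cat -!map_comp; congr (_ ++ _).
  by case: (is_north x).
apply: eq_map => m /=; rewrite /ycoord /xcoord /= /is_east /is_north.
by case: x => [y|] /=; lia.
Qed.

Lemma heights_shift h P : heights h P = [seq ((v.1 + h)%R, v.2) | v <- heights 0%R P].
Proof.
elim: P h => [|[x|] P IH] h //=; rewrite (IH (_ + _)%R) [in RHS]IH -map_comp.
  rewrite add0r; congr (_ :: _); apply: eq_map => v /=.
  by congr (_, _); lia.
by apply: eq_map => v /=; congr (_, _); lia.
Qed.

Lemma area_wordE P : area_word P = map fst (heights 0%R P).
Proof.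
elim: P => [|x P IH] //; rewrite area_word_cons IH.
by case: x => [x|] /=; rewrite [in RHS]heights_shift -!map_comp ?add0r.
Qed.

Lemma lettersE P : letters P = map snd (heights 0%R P).
Proof.
elim: P => [|x P IH] //; case: x => [x|] /=; rewrite heights_shift -map_comp;
  rewrite [LHS]/= -/(letters P) IH //=.
Qed.

Lemma heightsE P : zip (area_word P) (letters P) = heights 0%R P.
Proof. by rewrite area_wordE lettersE zip_unzip. Qed.

Lemma size_heights h P : size (heights h P) = nb_north P.
Proof. by elim: P h => [|[x|] P IH] h //=; rewrite IH. Qed.

Definition dletter : letter := (0, (0, false)).

(** Adding the shift makes all entries nonnegative, so [absz] loses nothing. *)
Definition word (P : lpath) : seq letter :=
  [seq (absz (v.1 + (shift P)%:Z)%R, v.2) | v <- zip (area_word P) (letters P)].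

Lemma size_word P : size (word P) = nb_north P.
Proof. by rewrite size_map heightsE size_heights. Qed.

Lemma size_area_word P : size (area_word P) = nb_north P.
Proof. by rewrite area_wordE size_map size_heights. Qed.

Lemma size_letters P : size (letters P) = nb_north P.
Proof. by rewrite lettersE size_map size_heights. Qed.

Lemma size_columns P : size (columns P) = nb_north P.
Proof. by rewrite -size_area_word !size_map. Qed.

Lemma aw_col P i : i < nb_north P -> aw P i = (i%:Z - (col P i)%:Z)%R.
Proof.
rewrite /aw /col; elim: P i => [|x P IH] i //; rewrite area_word_cons columns_cons.
case: x => [x|] /=.
  case: i => [|i] /= hi; first by rewrite subrr.
  have hi' : i < nb_north P by rewrite /nb_north /= in hi *; lia.
  rewrite (nth_map 0%R) ?size_area_word // IH //.
  by rewrite (nth_map 0) ?size_columns //; lia.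
move=> hi; have hi' : i < nb_north P by rewrite /nb_north /= in hi *; lia.
rewrite (nth_map 0%R) ?size_area_word // IH // (nth_map 0) ?size_columns //; lia.
Qed.

Lemma columns_sorted P : sorted leq (columns P).
Proof.
elim: P => [|x P IH] //; rewrite columns_cons.
have IH' : sorted leq (map (addn (is_east x)) (columns P)).
  by rewrite sorted_map; apply: sub_sorted IH => a b /=; rewrite leq_add2l.
by case: x IH' => [x|] //=; case: map => //= *; apply/andP.
Qed.

Lemma bigmin_seq (x : int) (s : seq int) (m := \big[Order.min/x]_(a <- s) a) :
  (m \in x :: s) /\ {in x :: s, forall a, (m <= a)%R}.
Proof.
rewrite /m {m}; elim: s => [|a s [IH1 IH2]].
  by rewrite big_nil mem_head; split=> // a; rewrite inE => /eqP->.
rewrite big_cons; set m := \big[_/_]_(_ <- s) _ in IH1 IH2 *; split.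
  by rewrite minEle; case: ifP => _; move: IH1; rewrite !inE ?eqxx ?orbT // => /orP[]->; rewrite ?orbT.
move=> b; rewrite !inE ge_min => /or3P[/eqP->|/eqP->|hb].
- by rewrite IH2 ?mem_head ?orbT.
- by rewrite lexx.
- by rewrite IH2 ?orbT // inE hb orbT.
Qed.

Lemma shiftP P : 0 < nb_north P ->
  (- (shift P)%:Z)%R \in area_word P /\ {in area_word P, forall a, (0 <= a + (shift P)%:Z)%R}.
Proof.
move=> P0; have a0 : (aw P 0 <= 0)%R by rewrite aw_col //; lia.
have m0 : aw P 0 \in area_word P by rewrite mem_nth ?size_area_word.
have [h1 h2] := bigmin_seq (aw P 0) (area_word P); rewrite /shift.
set m := \big[_/_]_(_ <- _) _ in h1 h2 *.
have E : ((absz (- m))%:Z = - m)%R.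
  by have := h2 _ (mem_head _ _); lia.
rewrite E opprK; split; first by move: h1; rewrite inE => /orP[/eqP->|].
by move=> a ha; have := h2 a; rewrite inE ha orbT => /(_ isT); lia.
Qed.

Lemma nth_word P i : i < nb_north P ->
  nth dletter (word P) i = (absz (aw P i + (shift P)%:Z)%R, (lab P i, dec P i)).
Proof.
move=> hi; rewrite (nth_map (0%R, (0, false))); last by rewrite heightsE size_heights.
rewrite nth_zip ?size_area_word ?size_letters //= /lab /dec.
rewrite !(nth_map (0, false)) ?size_letters //.
by case: (nth _ (letters P) i).
Qed.

Lemma lv_word P i : i < nb_north P ->
  ((lv (nth dletter (word P) i))%:Z = aw P i + (shift P)%:Z)%R.
Proof.
move=> hi; rewrite nth_word //= /lv /=.
have [|_ h] := @shiftP P; first exact: leq_ltn_trans hi.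
by have := h (aw P i); rewrite mem_nth ?size_area_word // => /(_ isT); lia.
Qed.

Lemma lb_word P i : i < nb_north P -> lb (nth dletter (word P) i) = lab P i.
Proof. by move=> hi; rewrite nth_word. Qed.

Lemma dc_word P i : i < nb_north P -> dc (nth dletter (word P) i) = dec P i.
Proof. by move=> hi; rewrite nth_word. Qed.

Lemma map_lb_word P : map lb (word P) = labels P.
Proof.
rewrite /word -map_comp /labels -[letters P in RHS](@unzip2_zip _ _ (area_word P)).
  by rewrite -map_comp.
by rewrite size_area_word size_letters.
Qed.

Lemma map_dc_word P : map dc (word P) = decs P.
Proof.
rewrite /word -map_comp /decs -[letters P in RHS](@unzip2_zip _ _ (area_word P)).
  by rewrite -map_comp.
by rewrite size_area_word size_letters.
Qed.

Lemma nb_dec_word P : nb_dec P = count dc (word P).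
Proof. by rewrite /nb_dec -map_dc_word count_map; apply: eq_count. Qed.

Lemma area_word_word P : 0 < nb_north P ->
  area_word P = [seq ((lv x)%:Z - (shift P)%:Z)%R | x <- word P].
Proof.
move=> P0; apply: (@eq_from_nth _ 0%R); first by rewrite [RHS]size_map size_word size_area_word.
move=> i; rewrite size_area_word => hi.
by rewrite (nth_map dletter) ?size_word // lv_word // addrK.
Qed.

Lemma area_sum P : 0 < nb_north P -> area P = sumn (map lv (word P)).
Proof.
move=> P0; rewrite /area {1}area_word_word // big_map.
under eq_bigr do rewrite subrK.
by rewrite -(big_morph Posz PoszD (erefl _)) sumnE big_map.
Qed.

Lemma count_neg P : 0 < nb_north P ->
  count (fun a : int => (a < 0)%R) (area_word P) = count (fun x => lv x < shift P) (word P).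
Proof.
by move=> P0; rewrite {1}area_word_word // count_map; apply: eq_count => x /=; lia.
Qed.

Lemma validE_nth N s u : u != [::] -> all (fun d => lb d < N) u ->
  valid N s u =
  [&& (lv (nth dletter u 0) < s) || ((lv (nth dletter u 0) == s) && ~~ dc (nth dletter u 0)),
      sorted follows u & s <= lv (nth dletter u (size u).-1)].
Proof. by case: u => // x u _ hN; rewrite validE // nth_last. Qed.

Lemma col_bound n P i : square_path n P -> i < n -> col P i < n.
Proof.
move=> /and3P[/eqP sz /eqP nN lE] hi; rewrite /col /columns.
rewrite (nth_map 0); last by move: hi; rewrite -nN -size_columns size_map.
set m := nth _ _ _; have: m \in north_pos P.
  by rewrite mem_nth //; move: hi; rewrite -nN -size_columns size_map.
rewrite mem_filter mem_iota /= add0n => /andP[nm mP].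
have eE : count is_east P = n.
  have := count_predC is_north P; rewrite -/(nb_north P) sz nN.
  by rewrite (@eq_count _ _ is_east) //; lia.
rewrite -[X in _ < X]eE /xcoord.
case/lastP: P lE sz nN {hi} m nm mP eE => [|P x] //.
rewrite last_rcons size_rcons => ex _ _ m nm; rewrite ltnS leq_eqVlt => /orP[/eqP mP|mP] _.
  by move: nm; rewrite nth_rcons mP ltnn eqxx /is_north; move: ex; rewrite /is_east; case: isSome.
rewrite -cats1 take_cat mP count_cat /= ex addn0 addn1 ltnS.
by rewrite -[X in _ <= count _ X](cat_take_drop m P) count_cat leq_addr.
Qed.

(** Adjacent letters share a column exactly when the level climbs by one, so [follows] combines the
    labeling condition on neighbours with contractibility; the end conditions come from the
    marker. *)
Lemma LSQ_word n k P N : 0 < n -> square_path n P -> uniq (labels P) ->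
  all (fun d => lb d < N) (word P) ->
  LSQ n k P = [&& all (fun c => 0 < c) (labels P), valid N (shift P) (word P)
                & count dc (word P) == k].
Proof.
move=> n0 sq uP hN; rewrite /LSQ sq /labeling nb_dec_word /= -!andbA; congr (_ && _).
rewrite !andbA; congr (_ && _).
have /and3P[_ /eqP nN _] := sq.
have w0 : word P != [::] by rewrite -size_eq0 size_word nN; lia.
rewrite validE_nth // size_word nN.
have lvE i : i < n -> ((lv (nth dletter (word P) i))%:Z = i%:Z - (col P i)%:Z + (shift P)%:Z)%R.
  by move=> hi; rewrite lv_word ?nN // aw_col ?nN.
have lbE i : i < n -> lb (nth dletter (word P) i) = lab P i by move=> hi; rewrite lb_word ?nN.
have dcE i : i < n -> dc (nth dletter (word P) i) = dec P i by move=> hi; rewrite dc_word ?nN.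
have awE i : i < n -> aw P i = (i%:Z - (col P i)%:Z)%R by move=> hi; rewrite aw_col ?nN.
have colS i : i.+1 < n -> col P i <= col P i.+1.
  by move=> hi; apply: (sortedP 0 (columns_sorted P)); rewrite size_columns nN.
have colB i : i < n -> col P i < n by apply: col_bound.
apply/andP/and3P.
  move=> [/forallP hl /forallP hd].
  have {}hl i : i.+1 < n -> col P i = col P i.+1 -> lab P i < lab P i.+1.
    move=> hi e; have /forallP/(_ (Ordinal hi)) := hl (Ordinal (ltnW hi)).
    by rewrite /= ltnSn e eqxx.
  have {}hd i : i < n -> dec P i -> contractible P i.
    by move=> hi; have /implyP := hd (Ordinal hi).
  split.
  - have := lvE 0 n0; rewrite dcE //; have := hd 0 n0; rewrite /= awE //.
    by case: (dec P 0) => /= [/(_ isT)|_]; lia.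
  - apply/(sortedP dletter) => i; rewrite size_word nN => hi.
    have := lvE _ hi; have := lvE _ (ltnW hi); have := hl _ hi; have := colS _ hi.
    have := hd _ hi; rewrite /= !awE ?(ltnW hi) // /follows !lbE ?dcE ?(ltnW hi) //.
    case: (dec P i.+1) => [/(_ isT)|_]; last first.
      by move=> c1 c2 h1 h2; case: (eqVneq (col P i) (col P i.+1)) => [/c2|]; lia.
    lia.
  - have := lvE n.-1; have := colB n.-1; lia.
move=> [h0 hs _]; split.
  have adj i : i.+1 < n -> col P i = col P i.+1 -> lab P i < lab P i.+1.
    move=> hi e; have := sortedP dletter hs i; rewrite size_word nN => /(_ hi).
    have := lvE _ hi; have := lvE _ (ltnW hi).
    by rewrite /follows !lbE ?(ltnW hi) //; case: dc; lia.
  (* Columns increase weakly, so two letters of one column have only letters of this column between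
     them, and the neighbour condition chains. *)
  have mono i j : i + j < n -> col P i <= col P (i + j).
    elim: j => [|j IH]; rewrite ?addn0 // addnS => hi.
    by apply: leq_trans (IH (ltnW hi)) _; apply: colS.
  have inc j i : i + j.+1 < n -> col P i = col P (i + j.+1) -> lab P i < lab P (i + j.+1).
    elim: j i => [|j IH] i; first by rewrite addn1; apply: adj.
    rewrite addnS -addSn => hi e.
    have h1 : i.+1 < n by lia.
    have h2 : col P i.+1 = col P i.
      apply/eqP; rewrite eqn_leq colS // andbT e; exact: mono.
    by apply: ltn_trans (adj i h1 (esym h2)) (IH _ hi _); rewrite h2.
  apply/forallP => i; apply/forallP => j; apply/implyP => /andP[ij /eqP e].
  have hj := ltn_ord j.
  have E : (j : nat) = i + (j - i).-1.+1 by lia.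
  by rewrite E; apply: inc; rewrite -E.
apply/forallP => i; apply/implyP => di; have hi := ltn_ord i.
case: (nat_of_ord i) hi di => [|m] hi di /=.
  by move: h0; have := lvE 0 n0; rewrite dcE // di awE //; lia.
have := sortedP dletter hs m; rewrite size_word nN => /(_ hi).
have := lvE _ hi; have := lvE _ (ltnW hi).
rewrite /follows !lbE ?dcE ?(ltnW hi) // di !awE ?(ltnW hi) //.
have : lab P m != lab P m.+1.
  by rewrite /lab nth_uniq ?size_map ?size_letters ?nN ?(ltnW hi) // neq_ltn ltnSn.
lia.
Qed.

Lemma nattacks_sum u : nattacks u =
  \sum_(0 <= i < size u) \sum_(0 <= j < size u)
     ((i < j) && attacks (nth dletter u i) (nth dletter u j)).
Proof.
elim: u => [|x u IH]; first by rewrite big_geq.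
rewrite /= big_nat_recl // big_nat_recl //= add0n; congr (_ + _).
  by rewrite -sum1_count (big_nth dletter) big_mkcond; apply: eq_bigr => j _; case: attacks.
by rewrite IH; apply: eq_bigr => i _; rewrite big_nat_recl //= add0n.
Qed.

Lemma nb_attackE P : nb_attack P = nattacks (word P).
Proof.
rewrite /nb_attack cardsE -sum1_card big_mkcond /=.
rewrite -(pair_bigA _ (fun i j : 'I_(nb_north P) => if attack P i j then 1 else 0)) /=.
rewrite nattacks_sum size_word big_mkord; apply: eq_bigr => i _.
rewrite big_mkord; apply: eq_bigr => j _.
have := @lv_word P i (ltn_ord i); have := @lv_word P j (ltn_ord j).
rewrite /attack /attacks !lb_word // !dc_word //.
case: (dec P i) => /=; rewrite ?andbF //; case: ltnP => //= _ h1 h2.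
by case: ifP; lia.
Qed.

Lemma sign_dinv P : 0 < nb_north P ->
  ((-1 : int) ^ dinv P = (-1) ^+ sign_exp (shift P) (word P))%R.
Proof.
move=> P0; rewrite /dinv nb_attackE count_neg // nb_dec_word /sign_exp -PoszD.
set a := (_ + _)%N; set b := count _ _.
rewrite expN1r -signr_odd -[RHS]signr_odd; congr (_ ^+ _)%R; congr nat_of_bool.
lia.
Qed.

(** * From words to lattice paths, and cutting *)

(* The path from height [h] to height [f] with word [u]. *)
Fixpoint build (f h : nat) (u : seq letter) : lpath :=
  if u is x :: u' then nseq (h - lv x) None ++ Some x.2 :: build f (lv x).+1 u'
  else nseq (h - f) None.

(** Guards the truncated subtractions [h - lv x] in [build]. *)
Fixpoint fits (h : nat) (u : seq letter) : bool :=
  if u is x :: u' then (lv x <= h) && fits (lv x).+1 u' else true.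

Definition end_height (h : nat) (u : seq letter) : nat :=
  last h [seq (lv x).+1 | x <- u].

Lemma nb_east P : count is_east P + nb_north P = size P.
Proof. by rewrite addnC -(count_predC is_north P); congr (_ + _); apply: eq_count. Qed.

(** The height [g] divides the east steps between the two words into those before the cut and those
    after it. *)
Lemma build_cat f g h u1 u2 : g <= end_height h u1 ->
  (if u2 is x :: _ then lv x <= g else f <= g) ->
  build f h (u1 ++ u2) = build g h u1 ++ build f g u2.
Proof.
rewrite /end_height; elim: u1 h => [|x u1 IH] h /= hg h2; last first.
  by rewrite IH // -catA.
case: u2 h2 => [|y u2] h2 /=.
  by rewrite -nseqD; congr nseq; lia.
by rewrite catA -nseqD; congr (nseq _ _ ++ _); lia.
Qed.

Lemma heights_nseq h m Q : heights h (nseq m None ++ Q) = heights (h - m%:Z)%R Q.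
Proof.
elim: m h => [|m IH] h /=; first by rewrite subr0.
by rewrite IH; congr heights; lia.
Qed.

Lemma heights_build s f h u : fits h u ->
  heights (h%:Z - s%:Z)%R (build f h u) = [seq (((lv x)%:Z - s%:Z)%R, x.2) | x <- u].
Proof.
elim: u h => [|x u IH] h /=; first by rewrite -[nseq _ _]cats0 heights_nseq.
move=> /andP[xh fu]; rewrite heights_nseq /= -(IH (lv x).+1) //.
by congr ((_, _) :: heights _ _); lia.
Qed.

Lemma nb_north_build f h u : nb_north (build f h u) = size u.
Proof.
elim: u h => [|x u IH] h; rewrite /nb_north /= ?count_cat count_nseq //=.
by rewrite -/(nb_north _) IH.
Qed.

Lemma size_build f h u : fits h u -> f <= end_height h u ->
  size (build f h u) + f = size u + size u + h.
Proof.
rewrite /end_height; elim: u h => [|x u IH] h /=; first by rewrite size_nseq; lia.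
move=> /andP[xh fu] hf; rewrite size_cat size_nseq /=.
by have := IH _ fu hf; lia.
Qed.

Lemma last_build z f h u : f < end_height h u -> last z (build f h u) = None.
Proof.
rewrite /end_height; elim: u h z => [|x u IH] h z /= hf; last by rewrite last_cat /= IH.
by rewrite (_ : h - f = (h - f).-1.+1) /=; [elim: (_.-1)|lia].
Qed.

Lemma valid_fits N s u : u != [::] -> all (fun d => lb d < N) u -> valid N s u ->
  fits s u && (s < end_height s u).
Proof.
case: u => // x u _ hN; rewrite validE // => /and3P[hx hu hl]; apply/andP; split.
  rewrite /=; apply/andP; split; first by lia.
  elim: u x {hx hN hl} hu => [|y u IH] x //= /andP[xy /IH->]; rewrite andbT.
  by move: xy; rewrite /follows; case: (dc y); lia.
by rewrite /end_height /= (last_map (fun x => (lv x).+1)) ltnS.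
Qed.

Lemma heights_head g P :
  if heights g P is v :: _ then (v.1 <= g)%R else nb_north P = 0 :> nat.
Proof.
elim: P g => [|[x|] P IH] g //=.
by have := IH (g - 1)%R; case: (heights _ _) => [|v l] //=; lia.
Qed.

Lemma build_heights P (h f s : nat) :
  all (fun v : int * (nat * bool) => 0 <= v.1 + s%:Z)%R (heights (h%:Z - s%:Z)%R P) ->
  f + count is_east P = h + nb_north P ->
  build f h [seq (absz (v.1 + s%:Z)%R, v.2) | v <- heights (h%:Z - s%:Z)%R P] = P.
Proof.
elim: P h => [|[x|] P IH] h /=.
- by rewrite /nb_north /= => _ E; rewrite (_ : h - f = 0) //; lia.
- rewrite subrK => /andP[_]; rewrite /nb_north /= subnn /=.
  rewrite (_ : (h%:Z - s%:Z + 1 = h.+1%:Z - s%:Z)%R); last lia.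
  by move=> hP E; rewrite IH // /nb_north; lia.
- rewrite /nb_north /= => hP E; have := heights_head (h%:Z - s%:Z - 1)%R P.
  have h0 : 0 < h.
    have := heights_head (h%:Z - s%:Z - 1)%R P; rewrite /nb_north.
    by case: (heights _ _) hP => [|v l] /=; lia.
  case: h h0 hP E => // h _; rewrite (_ : (h.+1%:Z - s%:Z - 1 = h%:Z - s%:Z)%R); last lia.
  move=> hP E hh; rewrite -[in RHS](IH h hP); last by rewrite /nb_north; lia.
  case: (heights _ _) hP hh => [|v l] /=.
    by rewrite /nb_north => _ n0; rewrite (_ : h.+1 - f = (h - f).+1) //; lia.
  by rewrite /lv /= => /andP[v0 _] vh; rewrite (_ : h.+1 - _ = (h - absz (v.1 + s%:Z)%R).+1) //; lia.
Qed.

Lemma heights_cat h P Q : heights h (P ++ Q) =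
  heights h P ++ heights (h + (nb_north P)%:Z - (count is_east P)%:Z)%R Q.
Proof.
elim: P h => [|[x|] P IH] h /=; rewrite ?IH /nb_north /=; [|congr (_ :: _)|];
  by congr (_ ++ heights _ _) || congr heights; lia.
Qed.

Lemma square_path_east n P : square_path n P -> count is_east P = n.
Proof. by case/and3P=> /eqP sz /eqP nN _; have := nb_east P; lia. Qed.

Lemma word_heights P : word P = [seq (absz (v.1 + (shift P)%:Z)%R, v.2) | v <- heights 0%R P].
Proof. by rewrite /word heightsE. Qed.

Lemma build_word n P : 0 < n -> square_path n P -> build (shift P) (shift P) (word P) = P.
Proof.
move=> n0 sq; have nN : nb_north P = n by case/and3P: sq => _ /eqP.
rewrite word_heights -(subrr (shift P)%:Z%R); apply: build_heights.
  rewrite subrr; apply/allP => v hv; have [_ h] := @shiftP P ltac:(by rewrite nN).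
  by apply: h; rewrite area_wordE map_f.
by rewrite nN (square_path_east sq).
Qed.

Lemma shift_unique P (s : nat) : 0 < nb_north P ->
  (- s%:Z)%R \in area_word P -> {in area_word P, forall a, (0 <= a + s%:Z)%R} -> shift P = s.
Proof.
by move=> P0 h1 h2; have [h3 h4] := shiftP P0; have := h4 _ h1; have := h2 _ h3; lia.
Qed.

(** The letter of level 0 makes [- s] the minimum of the area word, so that the shift is exactly
    [s]. *)
Lemma word_build N n s u : 0 < n -> size u = n -> all (fun d => lb d < N) u ->
  0 \in map lv u -> valid N s u ->
  [/\ square_path n (build s s u), shift (build s s u) = s & word (build s s u) = u].
Proof.
move=> n0 su hN z vu; have u0 : u != [::] by rewrite -size_eq0 su -lt0n.
have /andP[fu eu] := valid_fits u0 hN vu.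
have nN : nb_north (build s s u) = n by rewrite nb_north_build.
have hE : heights 0%R (build s s u) = [seq (((lv x)%:Z - s%:Z)%R, x.2) | x <- u].
  by rewrite -(heights_build s s fu) subrr.
have sE : shift (build s s u) = s.
  apply: shift_unique; rewrite ?nN // area_wordE hE -map_comp.
    by apply/mapP; case/mapP: z => x xu x0; exists x => //=; rewrite -x0; lia.
  by move=> a /mapP[x _ ->] /=; lia.
split=> //.
  apply/and3P; split; rewrite ?nN // ?last_build //.
  by have := size_build fu (ltnW eu); rewrite su; lia.
rewrite word_heights hE sE -map_comp -[RHS]map_id; apply: eq_map => x /=.
by rewrite subrK /=; case: x => a b.
Qed.

(** The pieces [A] and [B] have opposite displacements, so exchanging them lowers all heights by the
    same [d]; the shift grows by [d] and the levels stay the same. *)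
Lemma perm_word_rot n P m : 0 < n -> square_path n P ->
  perm_eq (word (drop m P ++ take m P)) (word P).
Proof.
move=> n0 sq; have nN : nb_north P = n by case/and3P: sq => _ /eqP.
have nE := square_path_east sq.
set A := take m P; set B := drop m P; have PE : P = A ++ B by rewrite cat_take_drop.
have nN' : nb_north (B ++ A) = n by rewrite -nN PE /nb_north !count_cat addnC.
have nNc : nb_north A + nb_north B = n by rewrite -nN PE /nb_north !count_cat.
have nEc : count is_east A + count is_east B = n by rewrite -nE PE !count_cat.
have [d dA dB] : exists2 d : int, (0 + (nb_north A)%:Z - (count is_east A)%:Z)%R = d
    & (0 + (nb_north B)%:Z - (count is_east B)%:Z)%R = (- d)%R.
  by exists ((nb_north A)%:Z - (count is_east A)%:Z)%R; lia.
have hp : perm_eq (heights 0%R (B ++ A)) [seq ((v.1 - d)%R, v.2) | v <- heights 0%R P].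
  rewrite PE !heights_cat map_cat perm_catC dA dB; apply: perm_cat.
    by rewrite heights_shift.
  rewrite [in X in perm_eq _ X]heights_shift -map_comp.
  rewrite (@eq_map _ _ _ id) ?map_id // => v /=.
  by rewrite addrK; case: v.
have ap : perm_eq (area_word (B ++ A)) [seq (a - d)%R | a <- area_word P].
  by rewrite !area_wordE -map_comp (perm_trans (perm_map fst hp)) // -map_comp.
have [h1 h2] := @shiftP P ltac:(by rewrite nN).
have [h3 h4] := @shiftP (B ++ A) ltac:(by rewrite nN').
have sE : ((shift (B ++ A))%:Z = (shift P)%:Z + d)%R.
  have : (- (shift P)%:Z - d)%R \in area_word (B ++ A).
    by rewrite (perm_mem ap); apply/mapP; exists (- (shift P)%:Z)%R.
  move/h4; move: h3; rewrite (perm_mem ap) => /mapP[a /h2]; lia.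
rewrite !word_heights sE (perm_trans (perm_map _ hp)) // -map_comp.
by rewrite (@eq_map _ _ _ (fun v => (absz (v.1 + (shift P)%:Z)%R, v.2))) // => v /=; congr (absz _, _); lia.
Qed.

Lemma cut_equiv_perm n k P Q : 0 < n -> square_path n P -> cut_equiv n k P Q ->
  perm_eq (word Q) (word P).
Proof.
move=> n0 sq; rewrite /cut_equiv mem_filter => /andP[_ /mapP[i _ ->]].
exact: perm_word_rot n0 sq.
Qed.

Lemma psi_rot n P m : square_path n P -> 0 < m <= size P -> is_east (nth None P m.-1) ->
  exists2 i, i \in iota 1 n & psi i P = drop m P ++ take m P.
Proof.
move=> sq /andP[m0 mP] hm; have hin : m.-1 \in east_pos P.
  by rewrite mem_filter hm mem_iota /=; lia.
have sE : size (east_pos P) = n.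
  rewrite -(square_path_east sq) size_filter -[in RHS](mkseq_nth None P) count_map.
  by apply: eq_count.
exists (index m.-1 (east_pos P)).+1; last first.
  by rewrite /psi /= nth_index // prednK.
by rewrite mem_iota /= add1n ltnS -sE index_mem.
Qed.

(** [P] runs through a piece [A] from height [s] to [s'] and a piece [B] back to [s]; the new path
    consists of the same pieces in the other order. *)
Lemma cut_equiv_build n k N P u1 u2 s' : 0 < n -> square_path n P ->
  all (fun d => lb d < N) (word P) -> valid N (shift P) (word P) -> word P = u1 ++ u2 ->
  s' <= lv (last (marker N (shift P)) u1) -> lv (head (marker N (shift P)) u2) <= s' ->
  LSQ n k (build s' s' (u2 ++ u1)) -> cut_equiv n k P (build s' s' (u2 ++ u1)).
Proof.
move=> n0 sq hN vP wE h1 h2 lsq; rewrite /cut_equiv mem_filter lsq /=.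
set s := shift P in vP h1 h2.
have nN : nb_north P = n by case/and3P: sq => _ /eqP.
have w0 : word P != [::] by rewrite -size_eq0 size_word nN -lt0n.
have /andP[fu eu] := valid_fits w0 hN vP.
have PE : P = build s' s u1 ++ build s s' u2.
  rewrite -[LHS](build_word n0 sq) wE; apply: build_cat.
    by move: h1; rewrite /end_height; case: (u1) => //= x v; rewrite (last_map (fun x => (lv x).+1)); lia.
  by case: (u2) h2.
have QE : build s' s' (u2 ++ u1) = build s s' u2 ++ build s' s u1.
  apply: build_cat.
    move: eu; rewrite wE /end_height map_cat last_cat.
    by case: (u2) h2 => [|x v] //= _; rewrite !(last_map (fun x => (lv x).+1)) => /ltnW.
  by move: h1 fu; rewrite wE; case: (u1) => [|x v] //= _ /andP[].
have lastQ : is_east (last None (build s' s' (u2 ++ u1))) by case/and4P: lsq => /and3P[].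
set A := build s' s u1 in PE QE; set B := build s s' u2 in PE QE.
suff [m [m0 em ->]] : exists m, [/\ 0 < m <= size P, is_east (nth None P m.-1)
    & build s' s' (u2 ++ u1) = drop m P ++ take m P].
  by have [i hi <-] := psi_rot sq m0 em; apply: map_f.
(* If [A] is empty the two paths coincide, and the cut is made after the last east step. *)
have [A0|A0] := posnP (size A).
  have /nilP AE : nilp A by rewrite /nilp A0.
  exists (size P); rewrite drop_size take_size /=.
  have sz : size P = n + n by case/and3P: sq => /eqP.
  split; first by rewrite sz; lia.
    by rewrite nth_last; case/and3P: sq.
  by rewrite QE [RHS]PE AE cats0.
exists (size A); split.
- by rewrite A0 PE size_cat leq_addr.
- by move: lastQ; rewrite QE last_cat PE nth_cat prednK // leqnn nth_last; case: (A) A0.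
- by rewrite PE take_size_cat // drop_size_cat.
Qed.

(** * The schedule word of a path *)

Lemma ascent_path i p v : path follows p v -> lv p <= i -> has (fun y => i < lv y) v ->
  exists p' x', [/\ p' \in p :: v, x' \in v, follows p' x' & lv p' <= i < lv x'].
Proof.
elim: v p => [|y v IH] p //= /andP[py yv] pi.
have [iy _|yi /= hv] := ltnP i (lv y).
  by exists p, y; rewrite !mem_head pi iy py.
have [p' [x' [h1 h2 h3 h4]]] := IH y yv yi hv.
by exists p', x'; rewrite !(inE, h2, orbT) h3 h4; move: h1; rewrite inE => ->; rewrite orbT.
Qed.

(** Going around the cyclic word, some step passes from level at most [i] to above [i]. It climbs
    one level to an undecorated letter with a larger label, so neither end is the marker. Such an
    ascent keeps two consecutive levels from merging into one decreasing run. *)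
Lemma ascent_exists N s u i : all (fun d => lb d < N) u -> valid N s u ->
  has (fun x => lv x <= i) u -> has (fun x => i < lv x) u ->
  exists p x, [/\ p \in u, x \in u & [/\ lv p = i, lv x = i.+1 & lb p < lb x]].
Proof.
move=> hN vu /hasP[x xu xi] /hasP[y yu yi].
have xu' : x \in marker N s :: u by rewrite inE xu orbT.
have [j v rE] := rot_to xu'; move: vu; rewrite /valid -(rot_cycle j) rE.
rewrite /= rcons_path => /andP[pv _].
have memE z : (z \in x :: v) = (z == marker N s) || (z \in u) by rewrite -rE mem_rot inE.
have yv : y \in v.
  by have := memE y; rewrite yu orbT inE => /orP[/eqP yx|//]; move: xi yi; rewrite yx; lia.
have [|p' [x' [h1 h2 h3 h4]]] := ascent_path pv xi; first by apply/hasP; exists y.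
have {h2} : x' \in x :: v by rewrite inE h2 orbT.
move: h1; rewrite !memE => hp hx.
have /and4P[/eqP E1 /eqP E2 E3 E4] :
    [&& lv p' == i, lv x' == i.+1, lb p' < lb x' & ~~ dc x'].
  by move: h3 h4; rewrite /follows; case: (dc x'); lia.
have {}hx : x' \in u by case/orP: hx => // /eqP xE; rewrite xE in E4.
have {}hp : p' \in u.
  by case/orP: hp => // /eqP pE; have := allP hN _ hx; move: E3; rewrite pE /lb /=; lia.
by exists p', x'.
Qed.

Lemma runs_cons y sg : exists r rs, runs (y :: sg) = (y :: r) :: rs.
Proof.
rewrite /=; case: (runs sg) => [|[|z r] rs]; try by exists [::], [::].
by case: ifP => _; [exists (z :: r), rs|exists [::], ((z :: r) :: rs)].
Qed.

Lemma runs_step x sg : runs (x :: sg) =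
  if runs sg is (z :: r) :: rs then
    if z.1 < x.1 then (x :: z :: r) :: rs else [:: x] :: (z :: r) :: rs
  else [:: [:: x]].
Proof. by []. Qed.

Lemma runs_cat r sg : r != [::] -> sorted (fun x y : nat * bool => y.1 < x.1) r ->
  (if sg is y :: _ then (last y r).1 <= y.1 else true) -> runs (r ++ sg) = r :: runs sg.
Proof.
elim: r => [|x r IH] // _; case: r IH => [|y r] IH sr hs.
  case: sg {IH sr} hs => [|y sg] // hs; rewrite cat1s runs_step.
  by have [r [rs ->]] := runs_cons y sg; rewrite ltnNge hs.
have /andP[xy yr] := sr.
have E : runs ((y :: r) ++ sg) = (y :: r) :: runs sg by apply: IH => //; case: (sg) hs.
by rewrite cat_cons runs_step E xy.
Qed.

Lemma runs_flatten (rs : seq (seq (nat * bool))) d :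
  all (fun r => (r != [::]) && sorted (fun x y : nat * bool => y.1 < x.1) r) rs ->
  sorted (fun r r' => (last d r).1 <= (head d r').1) rs ->
  runs (flatten rs) = rs.
Proof.
elim: rs => [|r rs IH] //= /andP[/andP[r0 sr] hrs] prs.
rewrite runs_cat ?IH ?(path_sorted prs) //.
case: rs hrs prs {IH} => [|[|y r'] rs] //= _ /andP[h _].
by case: r r0 h {sr}.
Qed.

Lemma eq_absz_shift (a : int) (s i : nat) : (0 <= a + s%:Z)%R ->
  (a == (i%:Z - s%:Z)%R) = (absz (a + s%:Z)%R == i).
Proof. by lia. Qed.

Lemma rhoE P i : 0 < nb_north P ->
  rho P i = sort (fun x y : nat * bool => y.1 <= x.1) [seq x.2 | x <- word P & lv x == i].
Proof.
move=> P0; rewrite /rho word_heights heightsE filter_map -map_comp; congr sort.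
have [_ h] := shiftP P0.
rewrite (@eq_in_filter _ _ (preim (fun v => (absz (v.1 + (shift P)%:Z)%R, v.2)) (fun x => lv x == i))).
  by [].
move=> v hv /=; rewrite /lv /=; have := h v.1; rewrite area_wordE map_f // => /(_ isT) v0.
exact: eq_absz_shift.
Qed.

Lemma count_rho P i (f : pred nat) : 0 < nb_north P ->
  count f [seq d.1 | d <- rho P i & ~~ d.2] = ucount (word P) i f.
Proof.
move=> P0; rewrite rhoE // count_map count_filter /ucount.
rewrite (permP (permEl (perm_sort _ _))) count_map count_filter; apply: eq_count => x /=.
by rewrite /lb /dc; case: (x.2.2); case: (f _); case: (_ == _).
Qed.

Lemma level0_exists P : 0 < nb_north P -> has (fun x => lv x == 0) (word P).
Proof.
move=> P0; have [h _] := shiftP P0; move: h; rewrite area_word_word // => /mapP[x xu E].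
by apply/hasP; exists x => //; lia.
Qed.

Lemma lv_lt_size n P : 0 < n -> square_path n P -> all (fun x => lv x < size P) (word P).
Proof.
move=> n0 sq; have /and3P[/eqP sz /eqP nN _] := sq.
apply/allP => x /(nthP dletter)[i]; rewrite size_word nN => hi <-.
have [h _] := @shiftP P ltac:(by rewrite nN); move: h; rewrite /area_word => /(nthP 0%R)[j].
rewrite -/(area_word P) size_area_word nN => hj; rewrite -/(aw P j) aw_col ?nN // => E.
have hl : lv (nth dletter (word P) i) < n + n.
  have := @lv_word P i; rewrite nN => /(_ hi); rewrite aw_col ?nN //.
  by have := col_bound sq hj; lia.
by rewrite sz.
Qed.

Section Sched.
Variables (n N : nat) (P : lpath).
Hypotheses (n0 : 0 < n) (sq : square_path n P) (uP : uniq (labels P))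
  (hN : all (fun d => lb d < N) (word P)) (vP : valid N (shift P) (word P)).

Let nN : nb_north P = n. Proof. by case/and3P: sq => _ /eqP. Qed.
Let P0 : 0 < nb_north P. Proof. by rewrite nN. Qed.
Let u := word P.
Let u0 : u != [::]. Proof. by rewrite -size_eq0 size_word nN -lt0n. Qed.
Let L := (\max_(x <- u) lv x).+1.

Lemma lv_lt_max : all (fun x => lv x < L) u.
Proof. by apply/allP => x xu; rewrite ltnS; apply: leq_bigmax_seq. Qed.

Lemma lv_max_exists : has (fun x => lv x == L.-1) u.
Proof.
rewrite /L /=; elim: (u) u0 => [|x v IH] // _; rewrite big_cons.
have [->|v0] := eqVneq v [::]; first by rewrite big_nil maxn0 /= eqxx.
rewrite /= maxnC /maxn; case: ifP => _; first by rewrite eqxx.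
by rewrite IH // orbT.
Qed.

Lemma rho_empty i : L <= i -> rho P i = [::].
Proof.
move=> Li; rewrite rhoE // (_ : filter _ _ = [::]) //.
apply/eqP; rewrite -size_eq0 size_filter -leqn0 leqNgt -has_count.
by apply/hasPn => x /(allP lv_lt_max); lia.
Qed.

Lemma L_le : L <= size P.
Proof. by case/hasP: lv_max_exists => x xu /eqP; have := allP (lv_lt_size n0 sq) x xu; lia. Qed.

Lemma mem_rho i c : (c \in rho P i) = ((i, c) \in u).
Proof.
rewrite rhoE // mem_sort; apply/mapP/idP => [[[a b]]|h].
  by rewrite mem_filter => /andP[/eqP /= <-] /[swap] ->.
by exists (i, c); rewrite // mem_filter eqxx.
Qed.

Lemma rho_sorted i : sorted (fun x y : nat * bool => y.1 < x.1) (rho P i).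
Proof.
have ge_total : total (fun x y : nat * bool => y.1 <= x.1) by move=> x y; lia.
have := sort_sorted ge_total [seq x.2 | x <- u & lv x == i]; rewrite -rhoE //.
have : uniq (map fst (rho P i)).
  rewrite rhoE // (perm_uniq (perm_map _ (permEl (perm_sort _ _)))) -map_comp.
  move: uP; rewrite -map_lb_word; apply: subseq_uniq; apply: map_subseq; exact: filter_subseq.
move=> h1 h2; have : sorted gtn (map fst (rho P i)).
  by rewrite gtn_sorted_uniq_geq h1 sorted_map.
by rewrite sorted_map.
Qed.

Lemma ascent i : i.+1 < L -> exists p x,
  [/\ p \in u, x \in u & [/\ lv p = i, lv x = i.+1 & lb p < lb x]].
Proof.
move=> iL; apply: ascent_exists hN vP _ _.
  by case/hasP: (level0_exists P0) => x xu /eqP x0; apply/hasP; exists x => //; rewrite x0.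
by case/hasP: lv_max_exists => x xu /eqP xL; apply/hasP; exists x => //; lia.
Qed.

Lemma rho_nonempty i : i < L -> rho P i != [::].
Proof.
case: i => [|i] iL.
  case/hasP: (level0_exists P0) => -[a b] xu /eqP /= x0.
  by apply/eqP => E; have := mem_rho 0 b; rewrite E -x0 xu.
have [p [[a b] [_ xu [_ xE _]]]] := ascent iL.
by apply/eqP => E; have := mem_rho i.+1 b; rewrite E -xE xu.
Qed.

(** The levels below [L] are nonempty, and an ascent from [p] to [x] bounds the last label of one
    level by the first label of the next. *)
Lemma runs_dw : runs (dw P) = [seq rho P i | i <- iota 0 L].
Proof.
have -> : dw P = flatten [seq rho P i | i <- iota 0 L].
  rewrite /dw -(subnKC L_le) iotaD map_cat flatten_cat add0n.
  rewrite [X in _ ++ X](_ : _ = [::]) ?cats0 //.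
  apply/nilP; rewrite /nilp size_flatten sumnE !big_map big_seq big1 // => i.
  by rewrite mem_iota => /andP[Li _]; rewrite rho_empty.
apply: (runs_flatten (d := (0, false))).
  by apply/allP => r /mapP[i]; rewrite mem_iota => /= iL ->; rewrite rho_nonempty // rho_sorted.
apply/(sortedP [::]) => i; rewrite size_map size_iota => iL.
rewrite !(nth_map 0) ?size_iota ?(ltnW iL) // !nth_iota ?(ltnW iL) // !add0n.
have [[a p] [[b x] [pu xu [/= pE xE px]]]] := ascent iL.
rewrite /lv /= in pE xE; rewrite {}pE in pu; rewrite {}xE in xu.
have tr : transitive (fun x y : nat * bool => y.1 < x.1).
  by move=> x' y' z' h1 h2; apply: ltn_trans h2 h1.
have lep : (last (0, false) (rho P i)).1 <= p.1.
  have := rho_sorted i; have: p \in rho P i by rewrite mem_rho.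
  elim/last_ind: (rho P i) => [|r z _] //; rewrite mem_rcons inE last_rcons => /orP[/eqP->//|pr].
  by rewrite (sorted_pairwise tr) pairwise_rcons => /andP[/allP/(_ p pr)/ltnW].
have gex : x.1 <= (head (0, false) (rho P i.+1)).1.
  have := rho_sorted i.+1; have: x \in rho P i.+1 by rewrite mem_rho.
  case: (rho P i.+1) => [|z r] //=; rewrite inE => /orP[/eqP->//|xr].
  by move=> /(order_path_min tr)/allP/(_ x xr)/ltnW.
by apply: leq_trans (leq_trans lep (ltnW px)) gex.
Qed.

Lemma sched_numE rs i c : (forall j, nth [::] rs j = rho P j) ->
  sched_num rs (shift P) i c = schedule (shift P) u (i, c).
Proof. by move=> h; rewrite /sched_num /schedule /urun !h !count_rho. Qed.

Lemma sched_oneP : (sched P == nseq n 1) <-> all_one (shift P) u.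
Proof.
have nthE j : nth [::] [seq rho P i | i <- iota 0 L] j = rho P j.
  have [jL|jL] := ltnP j L; first by rewrite (nth_map 0) ?size_iota // nth_iota.
  by rewrite nth_default ?size_map ?size_iota // rho_empty.
(* The last letter has level at least the shift, so the zero branch of [sched_word] does not
   occur. *)
have sL : shift P < L.
  have := vP; rewrite validE_nth // => /and3P[_ _ /leq_ltn_trans]; apply.
  apply: (allP lv_lt_max); apply: mem_nth; rewrite size_word nN; lia.
rewrite /sched /sched_word runs_dw size_map size_iota sL.
set l := flatten _.
have sl : size l = n.
  rewrite /l size_flatten /shape -map_comp sumnE big_map.
  rewrite (eq_bigr (fun i => count (fun x => lv x == i) u)); last first.
    by move=> i _ /=; rewrite size_map nthE rhoE // size_sort size_map size_filter.
  rewrite -nN -size_word -/u; move: (L) lv_lt_max => M; elim: (u) => [|x v IH] /=.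
    by move=> _; rewrite big1.
  move=> /andP[xL /IH vE]; rewrite big_split /= vE -[RHS]add1n; congr (_ + _).
  rewrite (bigD1_seq (lv x)) ?iota_uniq ?mem_iota //= eqxx big1 // => i.
  by rewrite eq_sym => /negbTE->.
rewrite -[in nseq n _]sl; split.
  move=> /eqP/all_pred1P/allP h [i c] cu; apply: h.
  apply/flatten_mapP; exists i; first by rewrite mem_iota; apply: (allP lv_lt_max _ cu).
  by rewrite nthE; apply/mapP; exists c; rewrite ?mem_rho // (sched_numE _ _ nthE).
move=> h; apply/eqP/all_pred1P/allP => w /flatten_mapP[i _]; rewrite nthE => /mapP[c].
by rewrite mem_rho => /h /eqP E ->; rewrite (sched_numE _ _ nthE) /= E.
Qed.

End Sched.

(** * Cutting classes *)

Lemma to_lpath_inj n : injective (@to_lpath n).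
Proof.
move=> P Q /inj_map E; apply/val_inj/E => -[[a b]|] [[c d]|] //= [h ->].
by rewrite (ord_inj h).
Qed.

Lemma to_lpath_surj n (Q : lpath) : size Q = n + n -> all (fun c => c < n.+1) (labels Q) ->
  exists P : stpath n, to_lpath P = Q.
Proof.
move=> sQ hQ; pose g (x : nat * bool) : 'I_n.+1 * bool := (inord x.1, x.2).
have sz : size [seq omap g y | y <- Q] == n + n by rewrite size_map sQ.
exists (Tuple sz); rewrite /to_lpath /= -map_comp; move: hQ; rewrite /labels /letters.
elim: (Q) => [|[[a b]|] R IH] //=; last by move=> /IH->.
by move=> /andP[aN /IH->]; rewrite inordK.
Qed.

Lemma all_one_perm s X Y : perm_eq X Y -> all_one s X -> all_one s Y.
Proof.
by move=> p h c; rewrite -(perm_mem p) => /h; rewrite (perm_schedule _ _ p).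
Qed.

Section Main.
Variables (n k : nat).
Hypothesis n0 : 0 < n.
Implicit Types P Q : stpath n.

Notation sh P := (shift (to_lpath P)).
Notation wd P := (word (to_lpath P)).

Lemma standard_lt u : perm_eq (map lb u) (iota 1 n) -> all (fun d => lb d < n.+1) u.
Proof.
move=> p; apply/allP => d /(map_f lb); rewrite (perm_mem p) mem_iota; lia.
Qed.

(** The conditions on the word of a path in [stLSQ n k] that do not depend on the order of the
    letters; a letter of level 0 must occur because the shift is minimal. *)
Definition admissible (u : seq letter) : bool :=
  [&& perm_eq (map lb u) (iota 1 n), count dc u == k & 0 \in map lv u].

Lemma admissible_perm u v : perm_eq u v -> admissible u = admissible v.
Proof.
move=> p; rewrite /admissible (permP p) (perm_mem (perm_map lv p)).
by rewrite (permPl (perm_map lb p)).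
Qed.

Lemma admissible_facts u : admissible u ->
  [/\ u != [::], uniq (map lb u), all (fun d => lb d < n.+1) u & size u = n].
Proof.
case/and3P=> p _ _; have sz : size u = n by rewrite -(size_map lb) (perm_size p) size_iota.
split=> //; last exact: standard_lt.
  by rewrite -size_eq0 sz -lt0n.
by rewrite (perm_uniq p) iota_uniq.
Qed.

Lemma stLSQP P : P \in stLSQ n k ->
  [/\ square_path n (to_lpath P), admissible (wd P) & valid n.+1 (sh P) (wd P)].
Proof.
rewrite inE => /andP[lsq st]; have sq : square_path n (to_lpath P) by case/and4P: lsq.
have nN : nb_north (to_lpath P) = n by case/and3P: sq => _ /eqP.
rewrite /standard -map_lb_word in st.
have uP : uniq (labels (to_lpath P)) by rewrite -map_lb_word (perm_uniq st) iota_uniq.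
move: lsq; rewrite (LSQ_word k n0 sq uP (standard_lt st)) => /and3P[_ vP dP].
split=> //; rewrite /admissible st dP /=.
by have /hasP[x xu /eqP <-] := @level0_exists (to_lpath P) ltac:(by rewrite nN); apply: map_f.
Qed.

Lemma stLSQ_build s u : admissible u -> valid n.+1 s u ->
  exists2 P, P \in stLSQ n k & sh P = s /\ wd P = u.
Proof.
move=> au vu; have [u0 uu hN su] := admissible_facts au; have /and3P[pu ku zu] := au.
have [sq sE wE] := word_build n0 su hN zu vu.
have lE : labels (build s s u) = map lb u by rewrite -map_lb_word wE.
have [||P PE] := @to_lpath_surj n (build s s u).
- by case/and3P: sq => /eqP.
- by rewrite lE all_map.
exists P; last by rewrite PE.
rewrite inE PE /standard lE pu andbT (LSQ_word k n0 sq _ (_ : all (fun d => lb d < n.+1) _)) ?lE ?wE ?sE //.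
rewrite vu ku !andbT; apply/allP => c; rewrite (perm_mem pu) mem_iota; lia.
Qed.

Lemma shift_word_inj P Q : P \in stLSQ n k -> Q \in stLSQ n k ->
  sh P = sh Q -> wd P = wd Q -> P = Q.
Proof.
move=> /stLSQP[sP _ _] /stLSQP[sQ _ _] s w; apply: to_lpath_inj.
by rewrite -(build_word n0 sP) -(build_word n0 sQ) s w.
Qed.

Lemma sched_oneE P : P \in stLSQ n k -> (P \in sched_one n k) <-> all_one (sh P) (wd P).
Proof.
move=> PE; have [sq au vP] := stLSQP PE; have [_ uu hN _] := admissible_facts au.
rewrite inE PE /=; apply: sched_oneP n0 sq _ hN vP.
by rewrite -map_lb_word.
Qed.

(** The shift is left free: a block collects the paths with given letters for all shifts. *)
Definition block P : {set stpath n} := [set Q in stLSQ n k | perm_eq (wd P) (wd Q)].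

(** Shift and word determine a path, and [build] realises every valid pair. The shift is at most the
    level of the last letter, hence less than [n + n]. *)
Lemma block_sum P : P \in stLSQ n k ->
  (\sum_(Q in block P) (-1) ^+ sign_exp (sh Q) (wd Q) =
   \sum_(0 <= s < n + n) \sum_(u <- perms (wd P) | valid n.+1 s u) (-1) ^+ sign_exp s u :> int)%R.
Proof.
move=> PE; have [sq au vP] := stLSQP PE; have [u0 uu hN su] := admissible_facts au.
pose F (p : nat * seq letter) : int := ((-1) ^+ sign_exp p.1 p.2)%R.
pose T := [seq p <- [seq (s, u) | s <- iota 0 (n + n), u <- perms (wd P)] | valid n.+1 p.1 p.2].
transitivity (\sum_(p <- T) F p)%R; last first.
  rewrite big_filter big_mkcond big_allpairs /index_iota subn0; apply: eq_bigr => s _.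
  by rewrite -big_mkcond.
transitivity (\sum_(p <- [seq (sh Q, wd Q) | Q <- enum (block P)]) F p)%R.
  by rewrite big_map big_enum.
apply: perm_big; apply: uniq_perm.
- rewrite map_inj_in_uniq ?enum_uniq // => Q Q'; rewrite !mem_enum !inE.
  by move=> /andP[h1 _] /andP[h2 _] [e1 e2]; apply: shift_word_inj => //; rewrite inE.
- apply: filter_uniq; apply: allpairs_uniq; rewrite ?iota_uniq ?perms_uniq //.
    exact: map_uniq uu.
  by move=> [a b] [c d].
move=> [s u]; rewrite mem_filter /=; apply/mapP/andP => [[Q]|[vu]].
  rewrite mem_enum inE => /andP[/stLSQP[sqQ aQ vQ] p] [-> ->]; split=> //.
  apply: allpairs_f; last by rewrite mem_perms perm_sym.
  rewrite mem_iota /= add0n.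
  have [w0 _ hQ sQ] := admissible_facts aQ.
  move: vQ; rewrite validE_nth // => /and3P[_ _ /leq_ltn_trans]; apply.
  have sz : size (to_lpath Q) = n + n by case/and3P: sqQ => /eqP.
  rewrite -[X in _ < X]sz; apply: (allP (lv_lt_size n0 sqQ)).
  by apply: mem_nth; rewrite sQ; lia.
case/allpairsP=> -[a b] /= [_ pb [ea eb]]; subst a b; move: pb; rewrite mem_perms => pb.
have [|Q QE [sE wE]] := @stLSQ_build s u _ vu; first by rewrite (admissible_perm pb).
by exists Q; rewrite ?mem_enum ?inE ?sE ?wE //; move: QE; rewrite inE => ->; rewrite perm_sym.
Qed.

Lemma block_meets P : P \in stLSQ n k ->
  (block P :&: sched_one n k != set0) <-> exists s, all_one s (wd P).
Proof.
move=> PE; have [sq au vP] := stLSQP PE; have [u0 uu hN su] := admissible_facts au.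
split.
  case/set0Pn=> Q; rewrite in_setI => /andP[]; rewrite inE => /andP[QE p] QD.
  exists (sh Q); apply: (all_one_perm (X := wd Q)); first by rewrite perm_sym.
  exact/(sched_oneE QE).
case=> s h; have [u pu vu] := all_one_exists uu hN h.
have [|Q QE [sE wE]] := @stLSQ_build s u _ vu; first by rewrite (admissible_perm pu).
apply/set0Pn; exists Q; rewrite in_setI inE QE wE perm_sym pu /=.
apply/(sched_oneE QE); rewrite sE wE; apply: all_one_perm h; by rewrite perm_sym.
Qed.

Lemma block_sum_value P : P \in stLSQ n k ->
  (\sum_(Q in block P) (-1) ^+ sign_exp (sh Q) (wd Q) =
   (odd (absz (n%:Z - k%:Z)) && (block P :&: sched_one n k != set0))%:R :> int)%R.
Proof.
move=> PE; rewrite block_sum //.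
have [sq au vP] := stLSQP PE; have [u0 uu hN su] := admissible_facts au.
have sz : size (to_lpath P) = n + n by case/and3P: sq => /eqP.
case: (boolP (_ != set0)) => [/(block_meets PE)[s h]|h]; last first.
  rewrite andbF signed_sum_not_one // => s hs; move/negP: h; apply.
  by apply/(block_meets PE); exists s.
rewrite andbT (signed_sum_all_one u0 uu hN _ h); last first.
  by rewrite -sz; apply: lv_lt_size sq.
congr (_%:R)%R; congr nat_of_bool.
have := count_predC dc (wd P); case/and3P: au => _ /eqP-> _; rewrite su.
set a := count _ _ => E; lia.
Qed.

Lemma area_block P Q : P \in stLSQ n k -> Q \in block P ->
  area (to_lpath Q) = area (to_lpath P).
Proof.
move=> PE; rewrite inE => /andP[QE p].
have [/and3P[_ /eqP nP _] _ _] := stLSQP PE; have [/and3P[_ /eqP nQ _] _ _] := stLSQP QE.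
by rewrite !area_sum ?nP ?nQ //; apply/perm_sumn/perm_map; rewrite perm_sym.
Qed.

Lemma class_area_block P (C : {set stpath n}) : P \in stLSQ n k -> C \subset block P ->
  C != set0 -> class_area C = area (to_lpath P).
Proof.
move=> PE /subsetP sub /set0Pn[Q QC]; rewrite /class_area.
by case: pickP => [Q' /sub/(area_block PE)|/(_ Q)] //; rewrite QC.
Qed.

(** Cuts preserve the letters. Conversely, the level given by the shift of [Q] has an undecorated
    letter, so [P] can be cut there, and the result is [Q] because only one valid word has these
    letters and this shift. *)
Lemma cut_equivE P Q : P \in sched_one n k -> Q \in sched_one n k ->
  cut_equiv n k (to_lpath P) (to_lpath Q) = perm_eq (wd P) (wd Q).
Proof.
move=> PD QD; have [PE QE] : P \in stLSQ n k /\ Q \in stLSQ n k.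
  by move: PD QD; rewrite inE => /andP[-> _]; rewrite inE => /andP[-> _].
have [sqP auP vP] := stLSQP PE; have [sqQ auQ vQ] := stLSQP QE.
have [u0 uu hN su] := admissible_facts auP.
apply/idP/idP => [/(cut_equiv_perm n0 sqP)|p]; first by rewrite perm_sym.
have h1 : all_one (sh Q) (wd P).
  by apply: (all_one_perm (X := wd Q)); [rewrite perm_sym|apply/(sched_oneE QE)].
have [_ s1 _] := all_odd_one u0 uu (all_one_odd h1).
have [|u1 [u2 [uE vE h2 h3]]] := @cut_exists n.+1 (sh P) (sh Q) (wd P) hN vP.
  by rewrite s1.
have wE : u2 ++ u1 = wd Q.
  apply: (all_one_unique uu hN h1 _ _ vE vQ); last by rewrite perm_sym.
  by rewrite uE perm_catC.
have bE : build (sh Q) (sh Q) (u2 ++ u1) = to_lpath Q by rewrite wE (build_word n0 sqQ).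
rewrite -bE; apply: cut_equiv_build n0 sqP hN vP uE h2 h3 _.
by rewrite bE; move: QE; rewrite inE => /andP[].
Qed.

Definition blocks : {set {set stpath n}} := [set block P | P in stLSQ n k].

Lemma blocks_partition : partition blocks (stLSQ n k).
Proof.
apply: (@equivalence_partitionP _ (fun P Q => perm_eq (wd P) (wd Q))).
by move=> P Q Q' _ _ _; split=> // /permPl->.
Qed.

Lemma mem_block P : P \in stLSQ n k -> P \in block P.
Proof. by move=> PE; rewrite inE PE perm_refl. Qed.

Lemma block_eq P Q : Q \in block P -> block Q = block P.
Proof.
rewrite inE => /andP[_ p]; apply/setP => Q'; rewrite !inE.
by rewrite (permPl p).
Qed.

(** By [cut_equivE] a cutting class is the part of a block inside [sched_one n k]. *)
Lemma cut_classesE :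
  cut_classes n k = [set A :&: sched_one n k | A in blocks & A :&: sched_one n k != set0].
Proof.
have sub P : P \in sched_one n k -> P \in stLSQ n k by rewrite inE => /andP[].
have E P : P \in sched_one n k ->
    [set Q in sched_one n k | cut_equiv n k (to_lpath P) (to_lpath Q)]
    = block P :&: sched_one n k.
  move=> PD; apply/setP => Q; rewrite inE in_setI [in RHS]inE.
  case QD: (Q \in sched_one n k); rewrite ?andbF //= andbT.
  by rewrite cut_equivE // sub.
apply/setP => C; apply/imsetP/imsetP => [[P PD ->]|[A]].
  exists (block P); last exact: E.
  rewrite inE imset_f ?sub //=; apply/set0Pn; exists P.
  by rewrite in_setI mem_block ?sub.
rewrite inE => /andP[/imsetP[P PE ->]] /set0Pn[Q]; rewrite in_setI => /andP[QP QD] ->.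
by exists Q => //; rewrite E // (block_eq QP).
Qed.

End Main.

(** * Summation over the blocks *)

Local Open Scope ring_scope.

Theorem mainTheorem2 (n k : nat) (n_gt0 : (0 < n)%N) :
  S_poly n k =
    if odd (absz (n%:Z - k%:Z))
    then \sum_(C in cut_classes n k) 'X^(class_area C)
    else 0.
Proof.
pose sgn P := ((-1 : int) ^+ sign_exp (shift (to_lpath P)) (word (@to_lpath n P)))%R.
(* The area is constant on a block, so each block contributes its signed sum times one monomial. *)
have E : (S_poly n k = \sum_(A in blocks n k)
   (\sum_(P in A) sgn P) *: 'X^(class_area A))%R.
  rewrite /S_poly (set_partition_big _ (blocks_partition n k)) /=.
  apply: eq_bigr => A /imsetP[P PE ->]; rewrite scaler_suml.
  apply: eq_bigr => Q QP; rewrite /sgn -sign_dinv; last first.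
    move: QP; rewrite inE => /andP[QE _].
    by have [/and3P[_ /eqP-> _] _ _] := stLSQP n_gt0 QE.
  rewrite (area_block n_gt0 PE QP) (class_area_block n_gt0 PE) //.
  by apply/set0Pn; exists Q.
rewrite {}E; under eq_bigr => A AE.
  have -> : (\sum_(P in A) sgn P =
      (odd (absz (n%:Z - k%:Z)) && (A :&: sched_one n k != set0))%:R)%R.
    by case/imsetP: AE => P PE ->; apply: block_sum_value.
  over.
case: ifP => [on|on] /=; last by apply: big1 => A _; rewrite scale0r.
(* Distinct blocks are disjoint, so a block is determined by its nonempty intersection with
   [sched_one n k]. *)
rewrite cut_classesE // [RHS]big_imset /=; last first.
  move=> A B /setIdP[/imsetP[P PE ->] /set0Pn[R RP]].
  move=> /setIdP[/imsetP[Q QE ->] _] PQ; have := RP; rewrite PQ.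
  move: RP; rewrite !in_setI => /andP[/block_eq RP _] /andP[/block_eq RQ _].
  by rewrite -RP RQ.
rewrite big_mkcond [RHS]big_mkcond; apply: eq_bigr => A _; rewrite [in RHS]inE.
case: ifP => //= /imsetP[P PE ->]; case: ifP => AD; last by rewrite scale0r.
rewrite scale1r !(class_area_block n_gt0 PE) ?subsetIl //.
by apply/set0Pn; exists P; apply: mem_block.
Qed.
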